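(* Let $n\ge 3$ be an integer and $\omega\in\mathbb R$, and define for $x>0$ $$F_n(x;\omega)=\bigl(\psi_2^{(n)}(x)\bigr)^2-\omega\,\psi_2^{(n-1)}(x)\,\psi_2^{(n+1)}(x).$$ (1) $x\mapsto F_n(x;\omega)$ is completely monotonic on $(0,\infty)$ if and only if $\omega\le \dfrac{n-2}{n-1}$. (2) $x\mapsto -F_n(x;\omega)$ is completely monotonic on $(0,\infty)$ if and only if $\omega\ge \dfrac{n}{n+1}$.
   Context: For an integer $n\ge 2$ and $x>0$, the poly-double gamma function is defined by $$\psi_2^{(n)}(x)=(-1)^{n+1}\,n!\sum_{k=0}^{\infty}\frac{1+k}{(x+k)^{n+1}} .$$ A real-valued $C^\infty$ function $f$ on $(0,\infty)$ is called completely monotonic if $(-1)^k f^{(k)}(x)\ge 0$ for all integers $k\ge 0$ and all $x>0$. *)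

(* Defs.v *)
From Stdlib Require Import Reals.
From Coquelicot Require Import Coquelicot.
Open Scope R_scope.

(* poly-double gamma function psi_2^{(n)}(x), for n >= 2, x > 0:
   (-1)^(n+1) n! sum_{k>=0} (1+k)/(x+k)^(n+1) *)
Definition psi2 (n : nat) (x : R) : R :=
  (-1) ^ (n + 1) * INR (Factorial.fact n) *
  Series (fun k : nat => (1 + INR k) / (x + INR k) ^ (n + 1)).

Definition completely_monotonic (f : R -> R) : Prop :=
  forall (k : nat) (x : R), 0 < x ->
    ex_derive_n f k x /\ 0 <= (-1) ^ k * Derive_n f k x.

Definition F_omega (n : nat) (w : R) (x : R) : R :=
  (psi2 n x) ^ 2 - w * psi2 (n - 1) x * psi2 (n + 1) x.

(* Main.v *)
Require Import Defs.
From Stdlib Require Import Reals Lra Lia.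
From Coquelicot Require Import Coquelicot.
Open Scope R_scope.

(** Write f_n(x) = n! sum_k (1+k)/(x+k)^(n+1), so that F_n = f_n^2 - w f_(n-1) f_(n+1),
    and f_n is the Laplace transform of t^n / (1-e^-t)^2.

    For w = n/(n+1), -F_n is a double series with terms
    (1+j)(1+k)(j-k)^2 (x+j)^-(n+2) (x+k)^-(n+2), each completely monotonic.

    For w = (n-2)/(n-1), replace the Laplace integral by its discretisation with step d:
    with q = e^-d and z = e^(-dx), f_n is the limit as d -> 0 of
    d^(n+1) (n-2)! sum_i (i/(1-q^i))^2 C(i+n-2, n-2) z^i.  The coefficient of z^N in the
    discretised F_n is sum_(i+j=N) p_i E_i with p_i = (i/(1-q^i) * j/(1-q^j))^2.  Without the
    weight p this sum is zero, because C(.+a, a) * C(.+b, b) (convolution) depends only on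
    a + b.  Up to a positive factor, the symmetrised E_i is an increasing function of ij, and
    so is p_i since i/(1-q^i) is log-concave; hence the coefficient is nonnegative by
    Chebyshev's sum inequality.  Limits of such combinations of exponentials have alternating
    finite differences of constant sign, and a smooth function with this property is
    completely monotonic by the mean value theorem.

    Other values of w are reached by adding a multiple of f_(n-1) f_(n+1).  The bounds on w are
    necessary because f_n(x) ~ (n-2)!/x^(n-1) at infinity and f_n(x) ~ n!/x^(n+1) at 0. *)

(** * Log-concavity and the nonnegativity of the Cauchy coefficients *)

(* The binomial coefficient C(i+m, m). *)
Fixpoint bin (m i : nat) : R :=
  match m with
  | O => 1
  | S m' => bin m' i * (INR i + INR m' + 1) / (INR m' + 1)
  end.

Lemma bin_pos (m i : nat) : 0 < bin m i.
Proof.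
  induction m as [|m IH]; simpl; [lra|].
  pose proof (pos_INR i); pose proof (pos_INR m).
  apply Rdiv_lt_0_compat; [apply Rmult_lt_0_compat|]; lra.
Qed.

Lemma bin_0_r (m : nat) : bin m 0 = 1.
Proof.
  induction m as [|m IH]; simpl; [reflexivity|].
  pose proof (pos_INR m). rewrite IH. field. lra.
Qed.

Lemma bin_S_l (m i : nat) :
  bin (S m) i * (INR m + 1) = bin m i * (INR i + INR m + 1).
Proof. pose proof (pos_INR m). simpl. field. lra. Qed.

Lemma bin_S_r (m i : nat) :
  bin m (S i) * (INR i + 1) = bin m i * (INR i + INR m + 1).
Proof.
  induction m as [|m IH]; [simpl; ring|].
  pose proof (pos_INR m).
  apply Rmult_eq_reg_r with (INR m + 1); [|lra].
  replace (bin (S m) (S i) * (INR i + 1) * (INR m + 1))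
    with (bin (S m) (S i) * (INR m + 1) * (INR i + 1)) by ring.
  replace (bin (S m) i * (INR i + INR (S m) + 1) * (INR m + 1))
    with (bin (S m) i * (INR m + 1) * (INR i + INR (S m) + 1)) by ring.
  rewrite !bin_S_l, !S_INR.
  replace (bin m (S i) * (INR i + 1 + INR m + 1) * (INR i + 1))
    with (bin m (S i) * (INR i + 1) * (INR i + 1 + INR m + 1)) by ring.
  rewrite IH. ring.
Qed.

Lemma bin_pascal (m i : nat) : bin (S m) (S i) = bin (S m) i + bin m (S i).
Proof.
  pose proof (pos_INR m).
  apply Rmult_eq_reg_r with (INR m + 1); [|lra].
  rewrite Rmult_plus_distr_r, !bin_S_l, S_INR, <- bin_S_r. ring.
Qed.

Lemma bin_sum (m N : nat) : sum_f_R0 (bin m) N = bin (S m) N.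
Proof.
  induction N as [|N IH]; simpl sum_f_R0.
  - now rewrite !bin_0_r.
  - now rewrite IH, bin_pascal.
Qed.

(* Both sides have generating function (1-y)^-(a+b+3). *)
Lemma bin_conv_shift (a b N : nat) :
  sum_f_R0 (fun i => bin (S a) i * bin b (N - i)) N =
  sum_f_R0 (fun i => bin a i * bin (S b) (N - i)) N.
Proof.
  induction N as [|N IH]; [cbn [sum_f_R0 Nat.sub]; now rewrite !bin_0_r|].
  rewrite decomp_sum by lia. simpl pred.
  rewrite tech5 with (An := fun i => bin a i * bin (S b) (S N - i)).
  rewrite (sum_eq _ (fun i => bin (S a) i * bin b (N - i)
             + bin a (S i) * bin b (S N - S i)))
    by (intros; rewrite bin_pascal; simpl Nat.sub; ring).
  rewrite (sum_eq (fun i => bin a i * bin (S b) (S N - i))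
     (fun i => bin a i * bin (S b) (N - i) + bin a i * bin b (S N - i)))
    by (intros i Hi; rewrite Nat.sub_succ_l by lia; rewrite bin_pascal; ring).
  rewrite !sum_plus, IH.
  (* Each side is now its value at [N] plus the convolution of [bin a] and [bin b] at [S N], with
     the term i = 0 split off on the left and the term i = [S N] on the right. The boundary factors
     are all 1. *)
  pose proof (decomp_sum (fun i => bin a i * bin b (S N - i)) (S N) ltac:(lia)) as H.
  rewrite tech5 in H. simpl pred in H.
  rewrite Nat.sub_diag, !bin_0_r in *.
  lra.
Qed.

Lemma sum_nonneg (f : nat -> R) (N : nat) :
  (forall i, (i <= N)%nat -> 0 <= f i) -> 0 <= sum_f_R0 f N.
Proof.
  induction N as [|N IH]; intros H; simpl; [apply H; lia|].
  apply Rplus_le_le_0_compat; [apply IH; intros; apply H|apply H]; lia.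
Qed.

(** The difference of the two sides is the sum over pairs i < j of k_i k_j (r_i - r_j)(p_i - p_j).
    The induction step adds the pairs that contain the new index. *)
Lemma chebyshev_sum (k r p : nat -> R) (N : nat) :
  (forall i, (i <= N)%nat -> 0 <= k i) ->
  (forall i j, (i <= N)%nat -> (j <= N)%nat -> 0 <= (r i - r j) * (p i - p j)) ->
  sum_f_R0 (fun i => k i * r i) N * sum_f_R0 (fun i => k i * p i) N <=
  sum_f_R0 k N * sum_f_R0 (fun i => k i * r i * p i) N.
Proof.
  induction N as [|N IH]; intros Hk Hrp; [simpl; lra|].
  assert (IH' := IH ltac:(intros; apply Hk; lia) ltac:(intros; apply Hrp; lia)).
  assert (H : 0 <= sum_f_R0 (fun i => k i * ((r i - r (S N)) * (p i - p (S N)))) N).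
  { apply sum_nonneg. intros i Hi. apply Rmult_le_pos; [apply Hk|apply Hrp]; lia. }
  assert (E : sum_f_R0 (fun i => k i * ((r i - r (S N)) * (p i - p (S N)))) N =
     sum_f_R0 (fun i => k i * r i * p i) N
     - p (S N) * sum_f_R0 (fun i => k i * r i) N
     - r (S N) * sum_f_R0 (fun i => k i * p i) N
     + r (S N) * p (S N) * sum_f_R0 k N).
  { rewrite !scal_sum, <- !minus_sum, <- sum_plus. apply sum_eq. intros; ring. }
  rewrite E in H. simpl sum_f_R0.
  specialize (Hk (S N) ltac:(lia)).
  apply Rmult_le_compat_l with (r := k (S N)) in H; [|lra].
  nra.
Qed.

(** * Log-concavity of i/(1-q^i) *)

(* Comparing 1 + q + ... + q^(i-1) with its geometric mean s^(i-1), where q = s^2. *)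
Lemma geom_sum_amgm (s : R) (i : nat) :
  0 < s < 1 -> INR (S i) * s ^ i * (1 - s ^ 2) <= 1 - (s ^ 2) ^ (S i).
Proof.
  intros Hs.
  (* Two consecutive cases are carried along, because the induction removes both end terms of the
     geometric sum at once. *)
  assert (H : forall i, INR (S i) * s ^ i * (1 - s ^ 2) <= 1 - (s ^ 2) ^ (S i) /\
     INR (S (S i)) * s ^ (S i) * (1 - s ^ 2) <= 1 - (s ^ 2) ^ (S (S i))).
  { clear i. induction i as [|i [IH1 IH2]].
    - assert (0 <= (1 - s ^ 2) * (1 - s) ^ 2)
        by (apply Rmult_le_pos; [nra|apply pow2_ge_0]).
      simpl in *. split; nra.
    - split; [assumption|].
      (* With y = s^(i+2) the two end terms are 1 and y^2, and 1 + y^2 >= 2y. The remaining terms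
         are q times the sum treated by [IH1]. *)
      assert (E : 1 - (s ^ 2) ^ (S (S (S i))) =
         (1 + (s ^ 2) ^ (S (S i))) * (1 - s ^ 2) + s ^ 2 * (1 - (s ^ 2) ^ (S i)))
        by (simpl; ring).
      rewrite E.
      assert (E2 : (s ^ 2) ^ (S (S i)) = s ^ (S (S i)) * s ^ (S (S i))).
      { rewrite <- pow_mult, <- pow_add. f_equal. lia. }
      rewrite E2.
      assert (INR (S (S (S i))) = INR (S i) + 2) as -> by (rewrite !S_INR; ring).
      apply Rmult_le_compat_l with (r := s ^ 2) in IH1; [|nra].
      replace (s ^ S (S i)) with (s ^ 2 * s ^ i) in * by (simpl; ring).
      set (y := s ^ 2 * s ^ i) in *.
      assert (0 <= (1 - s ^ 2) * (1 - y) ^ 2).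
      { apply Rmult_le_pos; [nra|apply pow2_ge_0]. }
      replace (s ^ 2 * (INR (S i) * s ^ i * (1 - s ^ 2))) with
        (INR (S i) * y * (1 - s ^ 2)) in IH1 by (unfold y; ring).
      nra. }
  apply H.
Qed.

(* The value at i = 0 is 0, as 0/0 = 0. *)
Definition qsigma (q : R) (i : nat) : R := INR i / (1 - q ^ i).

Lemma pow_S_lt_1 (q : R) (i : nat) : 0 < q < 1 -> 0 < q ^ S i < 1.
Proof.
  intros Hq. split; [apply pow_lt; lra|].
  apply pow_lt_1_compat; [lra|lia].
Qed.

Lemma qsigma_pos (q : R) (i : nat) : 0 < q < 1 -> 0 < qsigma q (S i).
Proof.
  intros Hq. pose proof (pow_S_lt_1 q i Hq).
  apply Rdiv_lt_0_compat; [apply lt_0_INR; lia|lra].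
Qed.

Lemma qsigma_0 (q : R) : qsigma q 0 = 0.
Proof. unfold qsigma. simpl. unfold Rdiv. ring. Qed.

Lemma qsigma_nonneg (q : R) (i : nat) : 0 < q < 1 -> 0 <= qsigma q i.
Proof.
  intros Hq. destruct i; [rewrite qsigma_0; lra|now apply Rlt_le, qsigma_pos].
Qed.

(** With n = i + 2, the identity (1-q^(n-1))(1-q^(n+1)) = (1-q^n)^2 - q^(n-1)(1-q)^2 reduces the
    claim to n^2 q^(n-1) (1-q)^2 <= (1-q^n)^2, the square of [geom_sum_amgm]. *)
Lemma qsigma_log_concave (q : R) (i : nat) : 0 < q < 1 ->
  qsigma q (S i) * qsigma q (S (S (S i))) <= qsigma q (S (S i)) ^ 2.
Proof.
  intros Hq.
  pose proof (pow_S_lt_1 q i Hq) as H1.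
  pose proof (pow_S_lt_1 q (S i) Hq) as H2.
  pose proof (pow_S_lt_1 q (S (S i)) Hq) as H3.
  assert (Hs : 0 < sqrt q < 1).
  { split; [apply sqrt_lt_R0; lra|]. rewrite <- sqrt_1. apply sqrt_lt_1; lra. }
  pose proof (geom_sum_amgm (sqrt q) (S i) Hs) as H.
  assert (Eq : sqrt q ^ 2 = q) by (apply pow2_sqrt; lra).
  rewrite Eq in H.
  assert (E : (sqrt q ^ S i) ^ 2 = q ^ S i).
  { rewrite <- pow_mult, Nat.mul_comm, pow_mult, Eq. reflexivity. }
  pose proof (pos_INR i).
  assert (Hsp : 0 < sqrt q ^ S i) by (apply pow_lt; lra).
  unfold qsigma.
  assert (K : INR (S (S i)) ^ 2 * q ^ S i * (1 - q) ^ 2 <= (1 - q ^ S (S i)) ^ 2).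
  { replace (INR (S (S i)) ^ 2 * q ^ S i * (1 - q) ^ 2) with
      ((INR (S (S i)) * sqrt q ^ S i * (1 - q)) ^ 2) by (rewrite <- E; ring).
    apply pow_incr. split; [|exact H].
    apply Rmult_le_pos; [apply Rmult_le_pos; [apply pos_INR|]|]; lra. }
  apply Rmult_le_reg_r with
    ((1 - q ^ S i) * (1 - q ^ S (S (S i))) * (1 - q ^ S (S i)) ^ 2).
  { repeat apply Rmult_lt_0_compat; lra. }
  replace (INR (S i) / (1 - q ^ S i) * (INR (S (S (S i))) / (1 - q ^ S (S (S i)))) *
    ((1 - q ^ S i) * (1 - q ^ S (S (S i))) * (1 - q ^ S (S i)) ^ 2)) with
    (INR (S i) * INR (S (S (S i))) * (1 - q ^ S (S i)) ^ 2) by (field; lra).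
  replace ((INR (S (S i)) / (1 - q ^ S (S i))) ^ 2 *
    ((1 - q ^ S i) * (1 - q ^ S (S (S i))) * (1 - q ^ S (S i)) ^ 2)) with
    (INR (S (S i)) ^ 2 * ((1 - q ^ S i) * (1 - q ^ S (S (S i))))) by (field; lra).
  replace ((1 - q ^ S i) * (1 - q ^ S (S (S i)))) with
    ((1 - q ^ S (S i)) ^ 2 - q ^ S i * (1 - q) ^ 2) by (simpl; ring).
  rewrite !S_INR in *. nra.
Qed.

(** By log-concavity the ratios of successive values decrease; this is that fact,
    cross-multiplied. *)
Lemma qsigma_ratio (q : R) (i d : nat) : 0 < q < 1 ->
  qsigma q (S i) * qsigma q (S (S (i + d))) <= qsigma q (S (S i)) * qsigma q (S (i + d)).
Proof.
  intros Hq. induction d as [|d IH].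
  - rewrite Nat.add_0_r. lra.
  - rewrite Nat.add_succ_r.
    pose proof (qsigma_log_concave q (i + d) Hq) as L.
    pose proof (qsigma_pos q (i + d) Hq) as P0.
    pose proof (qsigma_pos q (S (i + d)) Hq) as P1.
    pose proof (qsigma_pos q i Hq) as P.
    apply Rmult_le_reg_r with (qsigma q (S (i + d))); [assumption|].
    apply Rmult_le_compat_l with (r := qsigma q (S i)) in L; [|lra].
    apply Rmult_le_compat_r with (r := qsigma q (S (S (i + d)))) in IH; [|lra].
    nra.
Qed.

Lemma qsigma_prod_mono (q : R) (N i j : nat) : 0 < q < 1 ->
  (i <= j)%nat -> (2 * j <= N)%nat ->
  qsigma q i * qsigma q (N - i) <= qsigma q j * qsigma q (N - j).
Proof.
  intros Hq Hij. induction Hij as [|j Hij IH]; intros Hj; [lra|].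
  eapply Rle_trans; [apply IH; lia|].
  destruct j as [|j].
  (* The default value 0 at index 0 makes this first comparison trivial. *)
  - rewrite qsigma_0, Rmult_0_l.
    apply Rmult_le_pos; now apply qsigma_nonneg.
  - pose proof (qsigma_ratio q j (N - S (S j) - S j) Hq) as H.
    replace (S (S (j + (N - S (S j) - S j)))) with (N - S j)%nat in H by lia.
    replace (S (j + (N - S (S j) - S j))) with (N - S (S j))%nat in H by lia.
    exact H.
Qed.

Lemma qsigma_prod_le (q : R) (N i j : nat) : 0 < q < 1 ->
  (i <= j)%nat -> (i + j <= N)%nat ->
  qsigma q i * qsigma q (N - i) <= qsigma q j * qsigma q (N - j).
Proof.
  intros Hq Hij HN. destruct (Nat.le_gt_cases (2 * j) N).
  - now apply qsigma_prod_mono.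
  - pose proof (qsigma_prod_mono q N i (N - j) Hq ltac:(lia) ltac:(lia)) as M.
    replace (N - (N - j))%nat with j in M by lia. lra.
Qed.

(** Both i(N-i) and the product of the two [qsigma] values grow as i moves towards N/2, so they
    order the indices in the same way. This is the hypothesis of [chebyshev_sum]. *)
Lemma qsigma_prod_ordered (q : R) (N i j : nat) : 0 < q < 1 ->
  (i <= N)%nat -> (j <= N)%nat ->
  0 <= (INR i * INR (N - i) - INR j * INR (N - j)) *
       ((qsigma q i * qsigma q (N - i)) ^ 2 - (qsigma q j * qsigma q (N - j)) ^ 2).
Proof.
  intros Hq.
  assert (Pos : forall l, 0 <= qsigma q l * qsigma q (N - l))
    by (intros; apply Rmult_le_pos; now apply qsigma_nonneg).
  assert (Main : forall i j, (i <= N)%nat -> (j <= N)%nat -> (i <= j)%nat ->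
    0 <= (INR i * INR (N - i) - INR j * INR (N - j)) *
       ((qsigma q i * qsigma q (N - i)) ^ 2 - (qsigma q j * qsigma q (N - j)) ^ 2)).
  { clear i j. intros i j Hi Hj Hij.
    pose proof (le_INR _ _ Hij).
    assert (P1 := Pos i). assert (P2 := Pos j).
    rewrite !minus_INR by lia.
    replace (INR i * (INR N - INR i) - INR j * (INR N - INR j)) with
      ((INR j - INR i) * (INR i + INR j - INR N)) by ring.
    rewrite <- !plus_INR.
    destruct (Nat.le_gt_cases (i + j) N) as [C|C].
    - pose proof (qsigma_prod_le q N i j Hq Hij C) as K.
      apply le_INR in C.
      assert (K2 : (qsigma q i * qsigma q (N - i)) ^ 2 <= (qsigma q j * qsigma q (N - j)) ^ 2)
        by (apply pow_incr; lra).
      rewrite Rmult_assoc. apply Rmult_le_pos; [lra|].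
      nra.
    - pose proof (qsigma_prod_le q N (N - j) (N - i) Hq ltac:(lia) ltac:(lia)) as K.
      replace (N - (N - j))%nat with j in K by lia.
      replace (N - (N - i))%nat with i in K by lia.
      apply lt_INR in C.
      assert (K2 : (qsigma q j * qsigma q (N - j)) ^ 2 <= (qsigma q i * qsigma q (N - i)) ^ 2)
        by (apply pow_incr; lra).
      rewrite Rmult_assoc. apply Rmult_le_pos; [lra|]. apply Rmult_le_pos; lra. }
  intros Hi Hj. destruct (Nat.le_ge_cases i j).
  - now apply Main.
  - pose proof (Main j i Hj Hi ltac:(assumption)). nra.
Qed.

(** Symmetrising under i -> N - i turns [E] into [k i * r i], with [k] positive and [r] increasing
    in i(N-i). Since the [k]-weighted sum of [r] is 0, Chebyshev's inequality against [p] gives the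
    sign. *)
Lemma cauchy_coef_nonneg (q : R) (m N : nat) : 0 < q < 1 ->
  0 <= sum_f_R0 (fun i => (qsigma q i * qsigma q (N - i)) ^ 2 *
     (bin (S m) i * bin (S m) (N - i) - bin m i * bin (S (S m)) (N - i))) N.
Proof.
  intros Hq.
  pose proof (pos_INR m) as Hm.
  set (p := fun i => (qsigma q i * qsigma q (N - i)) ^ 2).
  set (k := fun i => bin m i * bin m (N - i)).
  set (E := fun i => bin (S m) i * bin (S m) (N - i) - bin m i * bin (S (S m)) (N - i)).
  (* As i^2 + (N-i)^2 = N^2 - 2i(N-i), the quotient of E_i + E_(N-i) by 2k_i is affine in i(N-i);
     [c] and [d] are its coefficients. *)
  set (c := / (INR m + 1) ^ 2 + / ((INR m + 1) * (INR m + 2))).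
  set (d := (INR m + 1) * (INR N + INR m + 1) / (INR m + 1) ^ 2
    - (INR N ^ 2 + INR N * (2 * INR m + 3) + 2 * (INR m + 1) * (INR m + 2))
      / (2 * ((INR m + 1) * (INR m + 2)))).
  set (r := fun i => c * (INR i * INR (N - i)) + d).
  assert (Hc : 0 < c).
  { unfold c. apply Rplus_lt_0_compat; apply Rinv_0_lt_compat; [apply pow_lt|
      apply Rmult_lt_0_compat]; lra. }
  assert (Sym : forall i, (i <= N)%nat -> E i + E (N - i)%nat = 2 * (k i * r i)).
  { intros i Hi. unfold E, k, r.
    replace (N - (N - i))%nat with i by lia.
    cbn [bin]. rewrite S_INR. unfold c, d. rewrite minus_INR by lia. field. lra. }
  assert (EqS : forall f, (forall i, (i <= N)%nat -> f (N - i)%nat = f i) ->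
     sum_f_R0 (fun i => f i * E i) N = sum_f_R0 (fun i => k i * r i * f i) N).
  { intros f Hf.
    assert (H2 : 2 * sum_f_R0 (fun i => f i * E i) N =
        2 * sum_f_R0 (fun i => k i * r i * f i) N).
    { rewrite (scal_sum (fun i => k i * r i * f i)).
      replace (2 * sum_f_R0 (fun i => f i * E i) N) with
        (sum_f_R0 (fun i => f i * E i) N + sum_f_R0 (fun i => f i * E i) N) by ring.
      rewrite <- (sum_f_R0_skip (fun i => f i * E i)) at 2.
      rewrite <- sum_plus. apply sum_eq. intros i Hi.
      rewrite Hf by assumption.
      replace (f i * E i + f i * E (N - i)%nat) with (f i * (E i + E (N - i)%nat)) by ring.
      rewrite Sym by assumption. ring. }
    lra. }
  (* With the constant weight 1 the sum is that of [E] alone, which [bin_conv_shift] cancels. *)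
  assert (Z : sum_f_R0 (fun i => k i * r i) N = 0).
  { rewrite (sum_eq _ (fun i => k i * r i * 1)) by (intros; ring).
    rewrite <- (EqS (fun _ => 1)) by reflexivity.
    rewrite (sum_eq _ (fun i => bin (S m) i * bin (S m) (N - i)
       - bin m i * bin (S (S m)) (N - i))) by (intros; unfold E; ring).
    rewrite minus_sum, bin_conv_shift. ring. }
  change (0 <= sum_f_R0 (fun i => p i * E i) N).
  rewrite EqS by (intros i Hi; unfold p; replace (N - (N - i))%nat with i by lia; ring).
  pose proof (chebyshev_sum k r p N) as C.
  rewrite Z, Rmult_0_l in C.
  assert (Kpos : forall i, 0 < k i)
    by (intros; unfold k; apply Rmult_lt_0_compat; apply bin_pos).
  assert (Spos : forall M, 0 < sum_f_R0 k M).
  { induction M as [|M IH]; simpl; [apply Kpos|]. pose proof (Kpos (S M)). lra. }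
  apply Rmult_le_reg_l with (sum_f_R0 k N); [apply Spos|].
  rewrite Rmult_0_r. apply C.
  - intros; now apply Rlt_le.
  - intros i j Hi Hj. unfold r, p.
    pose proof (qsigma_prod_ordered q N i j Hq Hi Hj).
    replace (c * (INR i * INR (N - i)) + d - (c * (INR j * INR (N - j)) + d)) with
      (c * (INR i * INR (N - i) - INR j * INR (N - j))) by ring.
    rewrite Rmult_assoc. apply Rmult_le_pos; lra.
Qed.

(** * Finite differences of alternating sign *)

(** This is (-1)^k times the usual forward difference, so that the expected sign is always
    nonnegative. *)
Fixpoint fdiff (h : R) (k : nat) (g : R -> R) (x : R) : R :=
  match k with
  | O => g x
  | S k' => fdiff h k' g x - fdiff h k' g (x + h)
  end.

(** A form of complete monotonicity free of derivatives, hence stable under pointwise limits. *)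
Definition diff_monotone (g : R -> R) : Prop :=
  forall h x k, 0 < h -> 0 < x -> 0 <= fdiff h k g x.

Lemma fdiff_S (h : R) (k : nat) (g : R -> R) (x : R) :
  fdiff h (S k) g x = fdiff h k (fun y => g y - g (y + h)) x.
Proof.
  revert x. induction k as [|k IH]; intros x; [reflexivity|].
  change (fdiff h (S k) g x - fdiff h (S k) g (x + h) =
    fdiff h k (fun y => g y - g (y + h)) x - fdiff h k (fun y => g y - g (y + h)) (x + h)).
  now rewrite !IH.
Qed.

Lemma fdiff_ext (h : R) (k : nat) (f g : R -> R) (x : R) : 0 < h -> 0 < x ->
  (forall y, 0 < y -> f y = g y) -> fdiff h k f x = fdiff h k g x.
Proof.
  intros Hh Hx E. revert x Hx. induction k as [|k IH]; intros x Hx; simpl; [auto|].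
  rewrite !IH by lra. reflexivity.
Qed.

Lemma fdiff_plus (h : R) (k : nat) (f g : R -> R) (x : R) :
  fdiff h k (fun y => f y + g y) x = fdiff h k f x + fdiff h k g x.
Proof.
  revert x. induction k as [|k IH]; intros x; simpl; [auto|]. rewrite !IH; ring.
Qed.

Lemma fdiff_scal (h : R) (k : nat) (c : R) (f : R -> R) (x : R) :
  fdiff h k (fun y => c * f y) x = c * fdiff h k f x.
Proof.
  revert x. induction k as [|k IH]; intros x; simpl; [auto|]. rewrite !IH; ring.
Qed.

Lemma fdiff_translate (h a : R) (k : nat) (f : R -> R) (x : R) :
  fdiff h k (fun y => f (y + a)) x = fdiff h k f (x + a).
Proof.
  revert x. induction k as [|k IH]; intros x; simpl; [auto|]. rewrite !IH.
  do 2 f_equal; ring.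
Qed.

Lemma fdiff_lim (h : R) (k : nat) (u : nat -> R -> R) (g : R -> R) (x : R) :
  0 < h -> 0 < x ->
  (forall y, 0 < y -> is_lim_seq (fun N => u N y) (g y)) ->
  is_lim_seq (fun N => fdiff h k (u N) x) (fdiff h k g x).
Proof.
  intros Hh Hx L. revert x Hx. induction k as [|k IH]; intros x Hx; simpl; [auto|].
  apply is_lim_seq_minus'; apply IH; lra.
Qed.

Lemma dm_ext (f g : R -> R) :
  (forall y, 0 < y -> f y = g y) -> diff_monotone f -> diff_monotone g.
Proof.
  intros E Hf h x k Hh Hx. rewrite <- (fdiff_ext h k f g) by assumption. now apply Hf.
Qed.

Lemma dm_lim (u : nat -> R -> R) (g : R -> R) :
  (forall y, 0 < y -> is_lim_seq (fun N => u N y) (g y)) ->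
  (forall N, diff_monotone (u N)) -> diff_monotone g.
Proof.
  intros L Hu h x k Hh Hx.
  apply (is_lim_seq_le (fun _ => 0) (fun N => fdiff h k (u N) x) 0 (fdiff h k g x)).
  - intros N. now apply Hu.
  - apply is_lim_seq_const.
  - now apply fdiff_lim.
Qed.

Lemma dm_plus (f g : R -> R) :
  diff_monotone f -> diff_monotone g -> diff_monotone (fun x => f x + g x).
Proof.
  intros Hf Hg h x k Hh Hx. rewrite fdiff_plus.
  apply Rplus_le_le_0_compat; auto.
Qed.

Lemma dm_scal (c : R) (f : R -> R) :
  0 <= c -> diff_monotone f -> diff_monotone (fun x => c * f x).
Proof.
  intros Hc Hf h x k Hh Hx. rewrite fdiff_scal. apply Rmult_le_pos; auto.
Qed.

Lemma dm_sum (u : nat -> R -> R) (N : nat) :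
  (forall i, diff_monotone (u i)) ->
  diff_monotone (fun x => sum_f_R0 (fun i => u i x) N).
Proof.
  intros Hu. induction N as [|N IH]; simpl; [apply Hu|]. now apply dm_plus.
Qed.

Lemma dm_series (u : nat -> R -> R) (g : R -> R) :
  (forall i, diff_monotone (u i)) ->
  (forall y, 0 < y -> is_series (fun i => u i y) (g y)) -> diff_monotone g.
Proof.
  intros Hu L.
  apply dm_lim with (u := fun N x => sum_f_R0 (fun i => u i x) N).
  - intros y Hy. apply is_lim_seq_ext with (sum_n (fun i => u i y)).
    + intros N. apply sum_n_Reals.
    + exact (L y Hy).
  - intros N. now apply dm_sum.
Qed.

(** Each difference multiplies the exponential by the nonnegative factor 1 - e^(-ah). *)
Lemma dm_exp (a : R) : 0 <= a -> diff_monotone (fun x => exp (- (a * x))).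
Proof.
  intros Ha h x k Hh Hx.
  assert (E : forall x, fdiff h k (fun x => exp (- (a * x))) x =
     (1 - exp (- (a * h))) ^ k * exp (- (a * x))).
  { induction k as [|k IH]; intros y; simpl; [ring|].
    rewrite !IH, Rmult_plus_distr_l, Ropp_plus_distr, exp_plus. ring. }
  rewrite E. apply Rmult_le_pos; [|apply Rlt_le, exp_pos].
  apply pow_le.
  pose proof (exp_ineq1_le (a * h)).
  assert (/ exp (a * h) <= / 1) by (apply Rinv_le_contravar; nra).
  rewrite exp_Ropp. lra.
Qed.

(* Leibniz rule: D(fg) = f Dg + Df g(.+h). *)
Lemma dm_mult (f g : R -> R) :
  diff_monotone f -> diff_monotone g -> diff_monotone (fun x => f x * g x).
Proof.
  intros Hf Hg h x k Hh Hx.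
  assert (Hf' : forall k x, 0 < x -> 0 <= fdiff h k f x) by (intros; now apply Hf).
  assert (Hg' : forall k x, 0 < x -> 0 <= fdiff h k g x) by (intros; now apply Hg).
  clear Hf Hg. revert f g x Hx Hf' Hg'.
  induction k as [|k IH]; intros f g x Hx Hf Hg.
  - simpl. apply Rmult_le_pos; [apply (Hf O)|apply (Hg O)]; assumption.
  - rewrite fdiff_S.
    rewrite (fdiff_ext h k _ (fun y => f y * (g y - g (y + h)) +
       (f y - f (y + h)) * g (y + h))) by (assumption || (intros; ring)).
    rewrite fdiff_plus. apply Rplus_le_le_0_compat; apply IH; auto; intros.
    + rewrite <- fdiff_S. now apply Hg.
    + rewrite <- fdiff_S. now apply Hf.
    + rewrite fdiff_translate. apply Hg; lra.
Qed.

Lemma dm_const (c : R) : 0 <= c -> diff_monotone (fun _ => c).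
Proof.
  intros Hc. apply dm_ext with (fun x => c * exp (- (0 * x))).
  - intros y _. rewrite Rmult_0_l, Ropp_0, exp_0. ring.
  - apply dm_scal; [assumption|]. apply dm_exp; lra.
Qed.

Lemma dm_pow (f : R -> R) (n : nat) :
  diff_monotone f -> diff_monotone (fun x => f x ^ n).
Proof.
  intros Hf. induction n as [|n IH]; simpl; [apply dm_const; lra|].
  now apply dm_mult.
Qed.

(** * From finite differences to derivatives *)

(** The induction hypothesis is applied to the family dg_i(y) - dg_i(y+h), and the ordinary mean
    value theorem to dg_k. Stating the result for a family of successive derivatives makes that
    substitution possible. *)
Lemma fdiff_mvt (k : nat) (h : R) (dg : nat -> R -> R) (x : R) : 0 < h -> 0 < x ->
  (forall i y, 0 < y -> is_derive (dg i) y (dg (S i) y)) ->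
  exists xi, x <= xi <= x + INR k * h /\
    fdiff h k (dg O) x = (- h) ^ k * dg k xi.
Proof.
  intros Hh Hx. revert dg. induction k as [|k IH]; intros dg D.
  - exists x. simpl. split; [lra|ring].
  - destruct (IH (fun i y => dg i y - dg i (y + h))) as [xi [Hxi E]].
    + intros i y Hy.
      apply (is_derive_minus (dg i) (fun y => dg i (y + h)) y (dg (S i) y) (dg (S i) (y + h))).
      * now apply D.
      * rewrite <- (scal_one (dg (S i) (y + h))).
        apply (is_derive_comp (dg i) (fun y => y + h) y (dg (S i) (y + h)) one).
        -- apply D; lra.
        -- auto_derive; [trivial|reflexivity].
    + destruct (MVT_gen (dg k) xi (xi + h) (dg (S k))) as [c [Hc Ec]].
      * rewrite Rmin_left, Rmax_right by lra. intros; apply D; lra.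
      * rewrite Rmin_left, Rmax_right by lra. intros y Hy.
        apply continuity_pt_filterlim.
        apply (ex_derive_continuous (dg k)). exists (dg (S k) y). apply D; lra.
      * rewrite Rmin_left, Rmax_right in Hc by lra.
        exists c. rewrite S_INR. split; [nra|].
        rewrite fdiff_S, E. simpl pow.
        replace (dg k xi - dg k (xi + h)) with (- (dg k (xi + h) - dg k xi)) by ring.
        rewrite Ec. ring.
Qed.

(** A wrong sign of the k-th derivative at x would persist on a neighbourhood. A step [h] with kh
    below its radius keeps the mean value point inside, so the k-th difference would be negative. *)
Lemma dm_completely_monotonic (g : R -> R) :
  (forall k x, 0 < x -> ex_derive_n g k x) -> diff_monotone g ->
  completely_monotonic g.
Proof.
  intros D Hg k x Hx. split; [now apply D|].
  assert (D' : forall i y, 0 < y ->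
    is_derive (Derive_n g i) y (Derive_n g (S i) y)).
  { intros i y Hy. apply Derive_correct. exact (D (S i) y Hy). }
  apply Rnot_lt_le. intros Neg.
  assert (C : continuous (fun y => (-1) ^ k * Derive_n g k y) x).
  { apply (continuous_mult (fun _ => (-1) ^ k) (Derive_n g k)).
    - apply continuous_const.
    - apply (ex_derive_continuous (Derive_n g k)). eexists. now apply D'. }
  destruct (C (fun v => v < 0) (open_lt 0 _ Neg)) as [e He].
  set (h := e / (2 * (INR k + 1))).
  pose proof (pos_INR k). pose proof (cond_pos e) as Pe.
  assert (Hh : 0 < h) by (apply Rdiv_lt_0_compat; lra).
  assert (Hkh : INR k * h < e).
  { apply Rle_lt_trans with (e / 2); [|lra].
    unfold h. apply Rmult_le_reg_r with (2 * (INR k + 1)); [lra|].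
    replace (INR k * (e / (2 * (INR k + 1))) * (2 * (INR k + 1))) with (INR k * e)
      by (field; lra). nra. }
  destruct (fdiff_mvt k h (Derive_n g) x Hh Hx D') as [xi [Hxi E]].
  pose proof (Hg h x k Hh Hx) as P.
  change (Derive_n g 0) with g in E. rewrite E in P.
  assert (N : (-1) ^ k * Derive_n g k xi < 0).
  { apply He. change (Rabs (xi - x) < e). rewrite Rabs_pos_eq; lra. }
  replace (- h) with (-1 * h) in P by ring. rewrite Rpow_mult_distr in P.
  pose proof (pow_lt h k Hh). nra.
Qed.

(** * Series *)

Lemma is_series_sum_f (a : nat -> R) (l : R) :
  is_series a l <-> is_lim_seq (sum_f_R0 a) l.
Proof.
  split; intros H.
  - apply is_lim_seq_ext with (sum_n a); [intros; apply sum_n_Reals|exact H].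
  - change (is_lim_seq (sum_n a) l).
    apply is_lim_seq_ext with (sum_f_R0 a); [intros; symmetry; apply sum_n_Reals|exact H].
Qed.

Lemma sum_le_is_series (a : nat -> R) (l : R) (N : nat) :
  (forall i, 0 <= a i) -> is_series a l -> sum_f_R0 a N <= l.
Proof.
  intros Ha H. apply is_series_sum_f in H.
  apply (is_lim_seq_incr_compare (sum_f_R0 a) l H).
  intros n. simpl. specialize (Ha (S n)). lra.
Qed.

Lemma Series_nonneg (a : nat -> R) :
  (forall i, 0 <= a i) -> ex_series a -> 0 <= Series a.
Proof.
  intros Ha H. apply Rle_trans with (sum_f_R0 a 0); [apply Ha|].
  apply sum_le_is_series; [exact Ha|now apply Series_correct].
Qed.

Lemma is_series_le (a b : nat -> R) (la lb : R) :
  (forall i, a i <= b i) -> is_series a la -> is_series b lb -> la <= lb.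
Proof.
  intros Hab Ha Hb. apply is_series_sum_f in Ha, Hb.
  apply (is_lim_seq_le (sum_f_R0 a) (sum_f_R0 b) la lb); try assumption.
  intros N. now apply sum_growing.
Qed.

Lemma ex_series_dom (a b : nat -> R) :
  (forall i, Rabs (a i) <= b i) -> ex_series b -> ex_series a.
Proof. intros H. exact (ex_series_le (V := R_CompleteNormedModule) a b H). Qed.

Lemma is_series_sum_swap (a : nat -> nat -> R) (b : nat -> R) (N : nat) :
  (forall i, is_series (a i) (b i)) ->
  is_series (fun k => sum_f_R0 (fun i => a i k) N) (sum_f_R0 b N).
Proof.
  intros H. induction N as [|N IH]; simpl; [apply H|].
  apply (is_series_plus _ (a (S N))); [exact IH|apply H].
Qed.

(** Tonelli for nonnegative double series: a finite sum commutes with a series, so every partial sum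
    in one order is bounded by the total in the other. *)
Lemma is_series_swap (a : nat -> nat -> R) (b c : nat -> R) (L : R) :
  (forall i k, 0 <= a i k) ->
  (forall i, is_series (a i) (b i)) ->
  (forall k, is_series (fun i => a i k) (c k)) ->
  is_series b L -> is_series c L.
Proof.
  intros Ha Hb Hc HL.
  assert (Pc : forall k, 0 <= c k).
  { intros k. apply Rle_trans with (sum_f_R0 (fun i => a i k) 0).
    - apply cond_pos_sum. intros; apply Ha.
    - now apply sum_le_is_series. }
  assert (Up : forall K, sum_f_R0 c K <= L).
  { intros K.
    apply (is_series_le (fun i => sum_f_R0 (fun k => a i k) K) b).
    - intros i. apply sum_le_is_series; auto.
    - apply (is_series_sum_swap (fun k i => a i k)). exact Hc.
    - exact HL. }
  destruct (ex_finite_lim_seq_incr (sum_f_R0 c) L) as [l Hl].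
  - intros n. simpl. specialize (Pc (S n)). lra.
  - exact Up.
  - assert (E : l = L); [|now rewrite <- E; apply is_series_sum_f].
    apply Rle_antisym.
    + apply (is_lim_seq_le (sum_f_R0 c) (fun _ => L) l L); auto.
      apply is_lim_seq_const.
    + apply is_series_sum_f in HL.
      apply (is_lim_seq_le (sum_f_R0 b) (fun _ => l) L l); auto.
      * intros I.
        apply (is_series_le (fun k => sum_f_R0 (fun i => a i k) I) c).
        -- intros k. apply sum_le_is_series; auto.
        -- apply is_series_sum_swap. exact Hb.
        -- now apply is_series_sum_f.
      * apply is_lim_seq_const.
Qed.

Lemma Series_split (a : nat -> R) (K : nat) : ex_series a ->
  Series a = sum_f_R0 a K + Series (fun k => a (S K + k)%nat).
Proof. intros H. now apply (Series_incr_n a (S K)); [lia|]. Qed.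

(** Dominated convergence for series: the tail of [M] bounds all tails uniformly in N, and a finite
    sum of limits remains. *)
Lemma tannery (t : nat -> nat -> R) (tl M : nat -> R) :
  (forall k, is_lim_seq (fun N => t N k) (tl k)) ->
  (forall N k, Rabs (t N k) <= M k) -> ex_series M ->
  is_lim_seq (fun N => Series (t N)) (Series tl).
Proof.
  intros Ht HM EM.
  assert (HMl : forall k, Rabs (tl k) <= M k).
  { intros k.
    apply (is_lim_seq_le (fun N => Rabs (t N k)) (fun _ => M k) (Rabs (tl k)) (M k)).
    - intros; apply HM.
    - apply (is_lim_seq_abs _ (tl k)), Ht.
    - apply is_lim_seq_const. }
  assert (Tail : forall u, (forall k, Rabs (u k) <= M k) ->
    ex_series u /\ forall K, Rabs (Series u - sum_f_R0 u K) <= Series M - sum_f_R0 M K).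
  { intros u Hu.
    assert (EA : ex_series (fun k => Rabs (u k))).
    { apply (ex_series_dom (fun k => Rabs (u k)) M); [|assumption].
      intros k. rewrite Rabs_Rabsolu. apply Hu. }
    assert (EU : ex_series u) by now apply ex_series_Rabs.
    split; [assumption|]. intros K.
    rewrite (Series_split u K EU), (Series_split M K EM).
    replace (sum_f_R0 u K + Series (fun k => u (S K + k)%nat) - sum_f_R0 u K)
      with (Series (fun k => u (S K + k)%nat)) by ring.
    replace (sum_f_R0 M K + Series (fun k => M (S K + k)%nat) - sum_f_R0 M K)
      with (Series (fun k => M (S K + k)%nat)) by ring.
    eapply Rle_trans; [apply Series_Rabs|apply Series_le].
    - now apply (ex_series_incr_n (fun k => Rabs (u k)) (S K)).
    - intros k. split; [apply Rabs_pos|apply Hu].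
    - now apply (ex_series_incr_n M (S K)). }
  apply is_lim_seq_spec. intros eps.
  pose proof (Series_correct M EM) as LM. apply is_series_sum_f in LM.
  apply is_lim_seq_spec in LM.
  destruct (LM (mkposreal (eps / 3) ltac:(pose proof (cond_pos eps); lra))) as [K HK].
  specialize (HK K (Nat.le_refl K)). simpl in HK.
  assert (LS : is_lim_seq (fun N => sum_f_R0 (t N) K) (sum_f_R0 tl K)).
  { clear - Ht. induction K as [|K IH]; simpl; [apply Ht|].
    now apply is_lim_seq_plus'. }
  apply is_lim_seq_spec in LS.
  destruct (LS (mkposreal (eps / 3) ltac:(pose proof (cond_pos eps); lra))) as [N0 HN].
  exists N0. intros N Hle. specialize (HN N Hle). simpl in HN.
  destruct (Tail (t N) (HM N)) as [_ T1]. destruct (Tail tl HMl) as [_ T2].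
  specialize (T1 K). specialize (T2 K).
  rewrite <- Rabs_Ropp, Ropp_minus_distr in HK.
  apply Rabs_def2 in HK. apply Rabs_def2 in HN.
  apply Rabs_le_between in T1. apply Rabs_le_between in T2.
  apply Rabs_def1; lra.
Qed.

(** * The series in psi2, and generating functions *)

(** Up to sign and factorial this is [psi2 (m - 1)]; its terms are positive for x > 0. *)
Definition dzeta (m : nat) (x : R) : R :=
  Series (fun k => (1 + INR k) / (x + INR k) ^ m).

Lemma ex_series_inv_succ_sq : ex_series (fun k => / (1 + INR k) ^ 2).
Proof.
  apply (ex_series_dom _ (fun k => 2 * (/ (1 + INR k) - / (2 + INR k)))).
  - intros k. pose proof (pos_INR k).
    change (Rabs (/ (1 + INR k) ^ 2) <= 2 * (/ (1 + INR k) - / (2 + INR k))).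
    rewrite Rabs_pos_eq by (apply Rlt_le, Rinv_0_lt_compat, pow_lt; lra).
    apply Rmult_le_reg_r with ((1 + INR k) ^ 2 * (2 + INR k)).
    { apply Rmult_lt_0_compat; [apply pow_lt|]; lra. }
    replace (/ (1 + INR k) ^ 2 * ((1 + INR k) ^ 2 * (2 + INR k))) with (2 + INR k)
      by (field; lra).
    replace (2 * (/ (1 + INR k) - / (2 + INR k)) * ((1 + INR k) ^ 2 * (2 + INR k)))
      with (2 * (1 + INR k)) by (field; lra).
    lra.
  - exists 2. apply is_series_sum_f.
    apply is_lim_seq_ext with (fun N => 2 * (1 - / (INR N + 2))).
    + intros N. induction N as [|N IH]; [simpl; field|].
      cbn [sum_f_R0]. rewrite <- IH, S_INR. pose proof (pos_INR N). field. lra.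
    + replace (Finite 2) with (Rbar_mult 2 (Rbar_minus 1 0)) by (simpl; f_equal; ring).
      apply is_lim_seq_scal_l. apply is_lim_seq_minus'; [apply is_lim_seq_const|].
      apply (is_lim_seq_inv (fun N => INR N + 2) p_infty); [|discriminate].
      eapply is_lim_seq_plus; [apply is_lim_seq_INR|apply is_lim_seq_const|reflexivity].
Qed.

Lemma ex_series_dzeta (m : nat) (x : R) : (3 <= m)%nat -> 0 < x ->
  ex_series (fun k => (1 + INR k) / (x + INR k) ^ m).
Proof.
  intros Hm Hx.
  (* Chosen so that 1 + k <= C(x + k) for all k, which compares the terms with 1/(1+k)^2. *)
  set (C := 1 + / x).
  assert (Px : 0 < / x) by now apply Rinv_0_lt_compat.
  apply (ex_series_dom _ (fun k => C ^ m * / (1 + INR k) ^ 2)).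
  2: { apply (ex_series_scal_l (C ^ m) (fun k => / (1 + INR k) ^ 2)).
       apply ex_series_inv_succ_sq. }
  intros k. pose proof (pos_INR k).
  assert (P : 0 < (x + INR k) ^ m) by (apply pow_lt; lra).
  change (Rabs ((1 + INR k) / (x + INR k) ^ m) <= C ^ m * / (1 + INR k) ^ 2).
  rewrite Rabs_pos_eq by (apply Rlt_le, Rdiv_lt_0_compat; lra).
  assert (K : (1 + INR k) ^ m <= C ^ m * (x + INR k) ^ m).
  { rewrite <- Rpow_mult_distr. apply pow_incr. split; [lra|].
    unfold C. replace ((1 + / x) * (x + INR k)) with
      (x + INR k + (1 + INR k * / x)) by (field; lra).
    assert (0 <= INR k * / x) by (apply Rmult_le_pos; lra). lra. }
  assert (K3 : (1 + INR k) ^ 3 <= (1 + INR k) ^ m) by (apply Rle_pow; lra || lia).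
  apply Rmult_le_reg_r with ((1 + INR k) ^ 2 * (x + INR k) ^ m).
  { apply Rmult_lt_0_compat; [apply pow_lt|]; lra. }
  replace ((1 + INR k) / (x + INR k) ^ m * ((1 + INR k) ^ 2 * (x + INR k) ^ m))
    with ((1 + INR k) ^ 3) by (field; lra).
  replace (C ^ m * / (1 + INR k) ^ 2 * ((1 + INR k) ^ 2 * (x + INR k) ^ m))
    with (C ^ m * (x + INR k) ^ m) by (field; lra).
  lra.
Qed.

(** Multiplying by the geometric series takes partial sums of coefficients, and [bin_sum] evaluates
    them. *)
Lemma bin_gf (m : nat) (y : R) : 0 <= y < 1 ->
  is_series (fun i => bin m i * y ^ i) (/ (1 - y) ^ (m + 1)).
Proof.
  intros Hy. induction m as [|m IH].
  - apply is_series_ext with (fun i => y ^ i); [intros; simpl; ring|].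
    simpl. rewrite Rmult_1_r. apply is_series_geom. rewrite Rabs_pos_eq; lra.
  - pose proof (is_series_mult_pos (fun i => bin m i * y ^ i) (fun i => y ^ i) _ _ IH
      (is_series_geom y ltac:(rewrite Rabs_pos_eq; lra))) as H.
    replace (/ (1 - y) ^ (S m + 1)) with (/ (1 - y) ^ (m + 1) * / (1 - y))
      by (simpl; rewrite Rinv_mult; ring).
    eapply is_series_ext; [|apply H].
    + intros N. cbv beta. rewrite <- bin_sum, Rmult_comm, scal_sum.
      apply sum_eq. intros i Hi.
      replace (y ^ N) with (y ^ i * y ^ (N - i)) by (rewrite <- pow_add; f_equal; lia).
      ring.
    + intros n. apply Rmult_le_pos; [apply Rlt_le, bin_pos|apply pow_le; lra].
    + intros n. apply pow_le; lra.
Qed.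

(** The generating function of i^2 C(i+m, m), written as a polynomial of degree m + 3 in v =
    1/(1-y). For y = e^(-cd) the product d v tends to 1/c, so the limit after scaling by d^(m+3) can
    be read off. *)
Definition gfun (m : nat) (y : R) : R :=
  (INR m + 1) * (/ (1 - y) - 1) * (/ (1 - y)) ^ (m + 1) *
  ((INR m + 2) * / (1 - y) - (INR m + 1)).

(** In the basis of binomials, i^2 C(i+m, m) is m+1 times (m+2) C(i+m+2, m+2) - (2m+3) C(i+m+1, m+1)
    + (m+1) C(i+m, m). *)
Lemma sq_bin_gf (m : nat) (y : R) : 0 <= y < 1 ->
  is_series (fun i => INR i ^ 2 * bin m i * y ^ i) (gfun m y).
Proof.
  intros Hy.
  pose proof (bin_gf m y Hy) as H0.
  pose proof (bin_gf (S m) y Hy) as H1.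
  pose proof (bin_gf (S (S m)) y Hy) as H2.
  pose proof (pos_INR m).
  apply (is_series_scal_l (INR m + 1) _ _) in H0.
  apply (is_series_scal_l (2 * INR m + 3) _ _) in H1.
  apply (is_series_scal_l (INR m + 2) _ _) in H2.
  pose proof (is_series_plus _ _ _ _ (is_series_minus _ _ _ _ H2 H1) H0) as H3.
  apply (is_series_scal_l (INR m + 1) _ _) in H3.
  replace (gfun m y) with (scal (INR m + 1) (plus
    (plus (scal (INR m + 2) (/ (1 - y) ^ (S (S m) + 1)))
       (opp (scal (2 * INR m + 3) (/ (1 - y) ^ (S m + 1)))))
    (scal (INR m + 1) (/ (1 - y) ^ (m + 1))))).
  - eapply is_series_ext; [|exact H3]. intros i.
    unfold scal, plus, minus, opp, mult; simpl; unfold mult; simpl.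
    replace (match m with 0%nat => 1 | S _ => INR m + 1 end) with (INR m + 1)
      by (destruct m; simpl; ring).
    unfold plus, opp; simpl. field. lra.
  - unfold scal, plus, opp, mult; simpl; unfold mult; simpl. unfold gfun.
    rewrite pow_inv, !Rinv_mult. field. split; [|apply pow_nonzero]; lra.
Qed.

(** * Discretised Laplace transforms *)

Lemma exp_opp_lt_1 (t : R) : 0 < t -> 0 < exp (- t) < 1.
Proof.
  intros Ht. split; [apply exp_pos|]. rewrite <- exp_0. apply exp_increasing. lra.
Qed.

Lemma exp_pow_nat (t : R) (n : nat) : exp t ^ n = exp (INR n * t).
Proof.
  induction n as [|n IH]; [simpl; now rewrite Rmult_0_l, exp_0|].
  rewrite S_INR, Rmult_plus_distr_r, Rmult_1_l, exp_plus, <- IH. simpl. ring.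
Qed.

Lemma inv_one_minus_exp_bounds (t : R) : 0 < t ->
  / t <= / (1 - exp (- t)) <= / t + 1.
Proof.
  intros Ht. pose proof (exp_opp_lt_1 t Ht).
  pose proof (exp_ineq1_le (- t)). pose proof (exp_ineq1_le t).
  split.
  - apply Rinv_le_contravar; lra.
  - assert (E : exp (- t) * exp t = 1) by (rewrite <- exp_plus, Rplus_opp_l; apply exp_0).
    replace (/ t + 1) with (/ (t / (1 + t))) by (field; lra).
    apply Rinv_le_contravar; [apply Rdiv_lt_0_compat; lra|].
    apply Rmult_le_reg_r with (1 + t); [lra|].
    replace (t / (1 + t) * (1 + t)) with t by (field; lra).
    nra.
Qed.

(** The n-th power of 1 + t <= n(1 + t/n) <= n e^(t/n). *)
Lemma pow_one_plus_le_exp (t : R) (n : nat) : 0 <= t -> (0 < n)%nat ->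
  (1 + t) ^ n <= INR n ^ n * exp t.
Proof.
  intros Ht Hn.
  assert (Pn : 1 <= INR n) by (apply (le_INR 1); lia).
  replace (exp t) with (exp (t / INR n) ^ n)
    by (rewrite exp_pow_nat; f_equal; field; lra).
  rewrite <- Rpow_mult_distr. apply pow_incr. split; [lra|].
  pose proof (exp_ineq1_le (t / INR n)) as H.
  apply Rmult_le_compat_l with (r := INR n) in H; [|lra].
  replace (INR n * (1 + t / INR n)) with (INR n + t) in H by (field; lra). lra.
Qed.

Definition step (N : nat) : R := / (INR N + 1).

Lemma step_pos (N : nat) : 0 < step N.
Proof. pose proof (pos_INR N). apply Rinv_0_lt_compat. lra. Qed.

Lemma step_lim : is_lim_seq step 0.
Proof.
  apply (is_lim_seq_inv (fun N => INR N + 1) p_infty); [|discriminate].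
  eapply is_lim_seq_plus; [apply is_lim_seq_INR|apply is_lim_seq_const|reflexivity].
Qed.

Lemma step_inv_exp_lim (c : R) : 0 < c ->
  is_lim_seq (fun N => step N * / (1 - exp (- (c * step N)))) (/ c).
Proof.
  intros Hc.
  apply is_lim_seq_le_le with (fun _ => / c) (fun N => / c + step N).
  - intros N. pose proof (step_pos N) as P.
    pose proof (inv_one_minus_exp_bounds (c * step N) ltac:(nra)) as [H1 H2].
    apply Rmult_le_compat_l with (r := step N) in H1; [|lra].
    apply Rmult_le_compat_l with (r := step N) in H2; [|lra].
    replace (step N * / (c * step N)) with (/ c) in H1 by (field; lra).
    replace (step N * (/ (c * step N) + 1)) with (/ c + step N) in H2 by (field; lra).
    lra.
  - apply is_lim_seq_const.
  - rewrite <- (Rplus_0_r (/ c)) at 1.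
    apply is_lim_seq_plus'; [apply is_lim_seq_const|apply step_lim].
Qed.

Lemma is_lim_seq_pow (u : nat -> R) (l : R) (n : nat) :
  is_lim_seq u l -> is_lim_seq (fun N => u N ^ n) (l ^ n).
Proof.
  intros H. induction n as [|n IH]; simpl; [apply is_lim_seq_const|].
  now apply is_lim_seq_mult'.
Qed.

Lemma gfun_step_lim (m : nat) (c : R) : 0 < c ->
  is_lim_seq (fun N => step N ^ (m + 3) * gfun m (exp (- (c * step N))))
    ((INR m + 1) * (INR m + 2) / c ^ (m + 3)).
Proof.
  intros Hc.
  pose proof (step_inv_exp_lim c Hc) as V.
  set (v := fun N => step N * / (1 - exp (- (c * step N)))) in *.
  apply is_lim_seq_ext with (fun N => (INR m + 1) * (v N - step N) * v N ^ (m + 1) *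
    ((INR m + 2) * v N - (INR m + 1) * step N)).
  - intros N. unfold gfun, v. rewrite Rpow_mult_distr, !pow_add. ring.
  - replace ((INR m + 1) * (INR m + 2) / c ^ (m + 3)) with
      ((INR m + 1) * (/ c - 0) * (/ c) ^ (m + 1) * ((INR m + 2) * / c - (INR m + 1) * 0)).
    + pose proof step_lim.
      repeat (apply is_lim_seq_mult' || apply is_lim_seq_minus' || apply is_lim_seq_const
        || apply is_lim_seq_pow || assumption).
    + rewrite !pow_add, pow_inv. field. split; [|apply pow_nonzero]; lra.
Qed.

(** A majorant for [tannery]: uniform in N and a constant multiple of the limit. With v <= (1+t)/t,
    the factor v - 1 = e^(-t) v supplies the decay that absorbs (1+t)^(m+3). *)
Lemma gfun_step_bound (m N : nat) (c : R) : 0 < c ->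
  0 <= step N ^ (m + 3) * gfun m (exp (- (c * step N))) <=
  (INR m + 1) * (INR m + 2) * INR (m + 3) ^ (m + 3) / c ^ (m + 3).
Proof.
  intros Hc. pose proof (step_pos N) as P. pose proof (pos_INR m) as Hm.
  set (t := c * step N). assert (Ht : 0 < t) by (unfold t; nra).
  pose proof (inv_one_minus_exp_bounds t Ht) as [_ B].
  pose proof (exp_opp_lt_1 t Ht) as Hy.
  set (v := / (1 - exp (- t))) in *.
  assert (V1 : 1 <= v).
  { unfold v. rewrite <- Rinv_1 at 1. apply Rinv_le_contravar; lra. }
  assert (Ev : v - 1 = exp (- t) * v) by (unfold v; field; lra).
  pose proof (pow_lt (step N) (m + 3) P) as Ps.
  assert (Pv : 0 < v ^ (m + 1)) by (apply pow_lt; lra).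
  pose proof (pow_lt c (m + 3) Hc) as Pc.
  change (0 <= step N ^ (m + 3) * ((INR m + 1) * (v - 1) * v ^ (m + 1) *
    ((INR m + 2) * v - (INR m + 1))) <=
    (INR m + 1) * (INR m + 2) * INR (m + 3) ^ (m + 3) / c ^ (m + 3)).
  split.
  - repeat apply Rmult_le_pos; nra.
  - apply Rle_trans with (step N ^ (m + 3) * ((INR m + 1) * (v - 1) * v ^ (m + 1) *
      ((INR m + 2) * v))).
    { apply Rmult_le_compat_l; [lra|]. apply Rmult_le_compat_l; [|lra].
      repeat apply Rmult_le_pos; lra. }
    rewrite Ev.
    replace (step N ^ (m + 3) * ((INR m + 1) * (exp (- t) * v) * v ^ (m + 1) *
      ((INR m + 2) * v))) with
      ((INR m + 1) * (INR m + 2) * (step N ^ (m + 3) * (exp (- t) * v ^ (m + 3))))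
      by (rewrite !pow_add; ring).
    unfold Rdiv. rewrite (Rmult_assoc _ (INR (m + 3) ^ (m + 3))).
    apply Rmult_le_compat_l; [nra|].
    assert (K : v ^ (m + 3) <= ((1 + t) * / t) ^ (m + 3)).
    { apply pow_incr. split; [lra|].
      replace ((1 + t) * / t) with (/ t + 1) by (field; lra). lra. }
    rewrite Rpow_mult_distr in K.
    pose proof (pow_one_plus_le_exp t (m + 3) ltac:(lra) ltac:(lia)) as K2.
    assert (Pt : 0 < (/ t) ^ (m + 3)) by (apply pow_lt, Rinv_0_lt_compat; lra).
    apply Rmult_le_compat_r with (r := (/ t) ^ (m + 3)) in K2; [|lra].
    assert (K3 : exp (- t) * v ^ (m + 3) <= INR (m + 3) ^ (m + 3) * (/ t) ^ (m + 3)).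
    { assert (E : exp (- t) * exp t = 1) by (rewrite <- exp_plus, Rplus_opp_l; apply exp_0).
      apply Rle_trans with (exp (- t) *
        (INR (m + 3) ^ (m + 3) * exp t * (/ t) ^ (m + 3))).
      - apply Rmult_le_compat_l; lra.
      - right. transitivity (exp (- t) * exp t * (INR (m + 3) ^ (m + 3) * (/ t) ^ (m + 3)));
          [ring|rewrite E; ring]. }
    apply Rmult_le_compat_l with (r := step N ^ (m + 3)) in K3; [|lra].
    eapply Rle_trans; [exact K3|]. right.
    unfold t. rewrite pow_inv, Rpow_mult_distr. field. split; lra.
Qed.

(** A Riemann sum for the Laplace transform of t^(m+2)/(1-e^-t)^2, without the power of the step and
    with [bin m i] in place of i^m/m!. This choice makes the convolution identity exact before the
    limit. *)
Definition approx (N m : nat) (x : R) : R :=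
  Series (fun i => qsigma (exp (- step N)) i ^ 2 * bin m i * exp (- (step N * x)) ^ i).

Lemma approx_term_nonneg (q z : R) (m i : nat) : 0 <= z ->
  0 <= qsigma q i ^ 2 * bin m i * z ^ i.
Proof.
  intros Hz. apply Rmult_le_pos; [apply Rmult_le_pos|].
  - apply pow2_ge_0.
  - apply Rlt_le, bin_pos.
  - now apply pow_le.
Qed.

Lemma is_series_approx (N m : nat) (x : R) : 0 < x ->
  is_series (fun i => qsigma (exp (- step N)) i ^ 2 * bin m i * exp (- (step N * x)) ^ i)
    (approx N m x).
Proof.
  intros Hx. apply Series_correct.
  pose proof (step_pos N) as P.
  pose proof (exp_opp_lt_1 _ P) as Hq.
  pose proof (exp_opp_lt_1 (step N * x) ltac:(nra)) as Hz.
  set (q := exp (- step N)) in *. set (z := exp (- (step N * x))) in *.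
  (* For i >= 1 one has q^i <= q, hence [qsigma q i] <= i/(1-q). *)
  apply ex_series_dom with (fun i => (/ (1 - q)) ^ 2 * (INR i ^ 2 * bin m i * z ^ i)).
  2: { apply (ex_series_scal_l ((/ (1 - q)) ^ 2) (fun i => INR i ^ 2 * bin m i * z ^ i)).
       exists (gfun m z). apply sq_bin_gf. lra. }
  intros i. rewrite Rabs_pos_eq by (apply approx_term_nonneg; lra).
  rewrite <- !Rmult_assoc, <- Rpow_mult_distr.
  apply Rmult_le_compat_r; [apply pow_le; lra|].
  apply Rmult_le_compat_r; [apply Rlt_le, bin_pos|].
  apply pow_incr. split; [now apply qsigma_nonneg|].
  destruct i as [|i]; [rewrite qsigma_0; simpl; lra|].
  unfold qsigma, Rdiv. rewrite Rmult_comm.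
  apply Rmult_le_compat_r; [apply pos_INR|].
  assert (q ^ S i <= q).
  { assert (q ^ i <= 1) by (rewrite <- (pow1 i); apply pow_incr; lra). simpl. nra. }
  apply Rinv_le_contravar; lra.
Qed.

(* Expand 1/(1-q^i)^2 as the series of (1+k) q^(ik) and sum over i first. *)
Lemma is_series_approx_gfun (N m : nat) (x : R) : 0 < x ->
  is_series (fun k => (1 + INR k) * gfun m (exp (- ((x + INR k) * step N))))
    (approx N m x).
Proof.
  intros Hx.
  pose proof (step_pos N) as P.
  pose proof (exp_opp_lt_1 _ P) as Hq.
  pose proof (exp_opp_lt_1 (step N * x) ltac:(nra)) as Hz.
  pose proof (is_series_approx N m x Hx) as HA.
  set (q := exp (- step N)) in *. set (z := exp (- (step N * x))) in *.
  refine (is_series_swap (fun i k => (1 + INR k) * (INR i ^ 2 * bin m i * (z * q ^ k) ^ i)) _ _ _ _ _ _ HA).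
  - intros i k. pose proof (pos_INR k). pose proof (bin_pos m i).
    apply Rmult_le_pos; [lra|].
    apply Rmult_le_pos; [apply Rmult_le_pos; [apply pow2_ge_0|lra]|].
    apply pow_le, Rmult_le_pos; [lra|apply pow_le; lra].
  - intros i. destruct i as [|i].
    + rewrite qsigma_0.
      apply is_series_ext with (fun k => 0 * q ^ k); [intros; simpl; ring|].
      replace (0 ^ 2 * bin m 0 * z ^ 0) with (scal 0 (/ (1 - q)))
        by (unfold scal, mult; simpl; unfold mult; simpl; ring).
      apply (is_series_scal_l 0 (fun k => q ^ k)), is_series_geom.
      rewrite Rabs_pos_eq; lra.
    + pose proof (pow_S_lt_1 q i Hq) as Hqi.
      (* The coefficients [bin 1 k] are 1 + k, which gives the expansion of 1/(1-q^i)^2. *)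
      pose proof (bin_gf 1 (q ^ S i) ltac:(lra)) as H1.
      apply (is_series_scal_l (INR (S i) ^ 2 * bin m (S i) * z ^ S i)) in H1.
      replace (qsigma q (S i) ^ 2 * bin m (S i) * z ^ S i) with
        (scal (INR (S i) ^ 2 * bin m (S i) * z ^ S i) (/ (1 - q ^ S i) ^ (1 + 1))).
      * eapply is_series_ext; [|exact H1]. intros k.
        change (INR (S i) ^ 2 * bin m (S i) * z ^ S i * (bin 1 k * (q ^ S i) ^ k) =
          (1 + INR k) * (INR (S i) ^ 2 * bin m (S i) * (z * q ^ k) ^ S i)).
        rewrite Rpow_mult_distr, <- !pow_mult, (Nat.mul_comm k).
        cbn [bin]. simpl (INR 0). field.
      * change (INR (S i) ^ 2 * bin m (S i) * z ^ S i * (/ (1 - q ^ S i) ^ (1 + 1)) =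
          qsigma q (S i) ^ 2 * bin m (S i) * z ^ S i).
        unfold qsigma. change (1 + 1)%nat with 2%nat. field. lra.
  - intros k.
    assert (E : exp (- ((x + INR k) * step N)) = z * q ^ k).
    { unfold z, q. rewrite exp_pow_nat, <- exp_plus. f_equal. ring. }
    rewrite E.
    apply (is_series_scal_l (1 + INR k) (fun i => INR i ^ 2 * bin m i * (z * q ^ k) ^ i)).
    apply sq_bin_gf.
    assert (q ^ k <= 1) by (rewrite <- (pow1 k); apply pow_incr; lra).
    pose proof (pow_lt q k (proj1 Hq)). nra.
Qed.

Lemma approx_lim (m : nat) (x : R) : 0 < x ->
  is_lim_seq (fun N => step N ^ (m + 3) * approx N m x)
    ((INR m + 1) * (INR m + 2) * dzeta (m + 3) x).
Proof.
  intros Hx.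
  set (t := fun N k => (1 + INR k) *
     (step N ^ (m + 3) * gfun m (exp (- ((x + INR k) * step N))))).
  apply is_lim_seq_ext with (fun N => Series (t N)).
  { intros N.
    rewrite <- (is_series_unique _ _ (is_series_approx_gfun N m x Hx)), <- Series_scal_l.
    apply Series_ext. intros k. unfold t. ring. }
  unfold dzeta. rewrite <- Series_scal_l.
  apply tannery with (fun k => (INR m + 1) * (INR m + 2) *
    INR (m + 3) ^ (m + 3) * ((1 + INR k) / (x + INR k) ^ (m + 3))).
  - intros k. pose proof (pos_INR k).
    replace ((INR m + 1) * (INR m + 2) * ((1 + INR k) / (x + INR k) ^ (m + 3))) with
      ((1 + INR k) * ((INR m + 1) * (INR m + 2) / (x + INR k) ^ (m + 3)))
      by (unfold Rdiv; ring).
    apply is_lim_seq_mult'; [apply is_lim_seq_const|].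
    apply gfun_step_lim. lra.
  - intros N k. pose proof (pos_INR k).
    pose proof (gfun_step_bound m N (x + INR k) ltac:(lra)) as [B1 B2].
    unfold t. rewrite Rabs_pos_eq by (apply Rmult_le_pos; lra).
    apply Rmult_le_compat_l with (r := 1 + INR k) in B2; [|lra].
    eapply Rle_trans; [exact B2|]. right. unfold Rdiv. ring.
  - apply (ex_series_scal_l ((INR m + 1) * (INR m + 2) * INR (m + 3) ^ (m + 3))
      (fun k => (1 + INR k) / (x + INR k) ^ (m + 3))).
    apply ex_series_dzeta; [lia|assumption].
Qed.

(** The Cauchy product is a power series in z = e^(-dx) with nonnegative coefficients by
    [cauchy_coef_nonneg], and each power of z is a decaying exponential in x. *)
Lemma dm_approx (N m : nat) :
  diff_monotone (fun x => approx N (S m) x ^ 2 - approx N m x * approx N (S (S m)) x).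
Proof.
  pose proof (step_pos N) as P.
  pose proof (exp_opp_lt_1 _ P) as Hq.
  set (q := exp (- step N)) in *.
  set (coef := fun M => sum_f_R0 (fun i => (qsigma q i * qsigma q (M - i)) ^ 2 *
     (bin (S m) i * bin (S m) (M - i) - bin m i * bin (S (S m)) (M - i))) M).
  apply dm_series with (fun M x => coef M * exp (- (INR M * step N * x))).
  - intros M. apply dm_scal.
    + now apply cauchy_coef_nonneg.
    + apply dm_exp. apply Rmult_le_pos; [apply pos_INR|lra].
  - intros x Hx.
    pose proof (exp_opp_lt_1 (step N * x) ltac:(nra)) as Hz.
    pose proof (is_series_approx N m x Hx) as H0.
    pose proof (is_series_approx N (S m) x Hx) as H1.
    pose proof (is_series_approx N (S (S m)) x Hx) as H2.
    assert (Nn : forall m i, 0 <= qsigma (exp (- step N)) i ^ 2 * bin m i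
       * exp (- (step N * x)) ^ i) by (intros; apply approx_term_nonneg; lra).
    pose proof (is_series_mult_pos _ _ _ _ H1 H1 (Nn _) (Nn _)) as H11.
    pose proof (is_series_mult_pos _ _ _ _ H0 H2 (Nn _) (Nn _)) as H02.
    pose proof (is_series_minus _ _ _ _ H11 H02) as H.
    replace (approx N (S m) x ^ 2) with (approx N (S m) x * approx N (S m) x) by ring.
    eapply is_series_ext; [|exact H]. intros M.
    change (sum_f_R0 (fun i => qsigma q i ^ 2 * bin (S m) i * exp (- (step N * x)) ^ i *
        (qsigma q (M - i) ^ 2 * bin (S m) (M - i) * exp (- (step N * x)) ^ (M - i))) M -
      sum_f_R0 (fun i => qsigma q i ^ 2 * bin m i * exp (- (step N * x)) ^ i *
        (qsigma q (M - i) ^ 2 * bin (S (S m)) (M - i) * exp (- (step N * x)) ^ (M - i))) M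
      = coef M * exp (- (INR M * step N * x))).
    rewrite <- minus_sum. unfold coef. rewrite (Rmult_comm (sum_f_R0 _ M)), scal_sum.
    apply sum_eq. intros i Hi.
    replace (exp (- (INR M * step N * x))) with
      (exp (- (step N * x)) ^ i * exp (- (step N * x)) ^ (M - i)).
    + ring.
    + rewrite <- pow_add, exp_pow_nat. f_equal.
      replace (i + (M - i))%nat with M by lia. ring.
Qed.

Lemma dm_dzeta_turan (m : nat) :
  diff_monotone (fun x =>
    (INR m + 2) * (INR m + 3) * dzeta (m + 4) x ^ 2 -
    (INR m + 1) * (INR m + 4) * dzeta (m + 3) x * dzeta (m + 5) x).
Proof.
  pose proof (pos_INR m) as Hm.
  apply dm_ext with (fun x => / ((INR m + 2) * (INR m + 3)) *
    (((INR m + 2) * (INR m + 3) * dzeta (m + 4) x) ^ 2 -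
    ((INR m + 1) * (INR m + 2) * dzeta (m + 3) x) *
    ((INR m + 3) * (INR m + 4) * dzeta (m + 5) x))).
  { intros y _. field. lra. }
  apply dm_scal; [apply Rlt_le, Rinv_0_lt_compat; nra|].
  (* Both products scale by the same power, since (m+3) + (m+5) = 2(m+4). *)
  apply dm_lim with (fun N x => step N ^ (2 * (m + 4)) *
    (approx N (S m) x ^ 2 - approx N m x * approx N (S (S m)) x)).
  - intros y Hy.
    apply is_lim_seq_ext with (fun N => (step N ^ (m + 4) * approx N (S m) y) ^ 2 -
      step N ^ (m + 3) * approx N m y * (step N ^ (m + 5) * approx N (S (S m)) y)).
    { intros N. replace (2 * (m + 4))%nat with (m + 4 + (m + 4))%nat by lia.
      rewrite !pow_add. ring. }
    pose proof (approx_lim m y Hy) as L0.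
    pose proof (approx_lim (S m) y Hy) as L1.
    pose proof (approx_lim (S (S m)) y Hy) as L2.
    replace (S m + 3)%nat with (m + 4)%nat in L1 by lia.
    replace (S (S m) + 3)%nat with (m + 5)%nat in L2 by lia.
    rewrite !S_INR in *.
    replace (INR m + 1 + 1) with (INR m + 2) in * by ring.
    replace (INR m + 1 + 2) with (INR m + 3) in * by ring.
    replace (INR m + 2 + 1) with (INR m + 3) in * by ring.
    replace (INR m + 2 + 2) with (INR m + 4) in * by ring.
    apply is_lim_seq_minus'; [now apply is_lim_seq_pow|now apply is_lim_seq_mult'].
  - intros N. apply dm_scal; [apply pow_le, Rlt_le, step_pos|]. apply dm_approx.
Qed.

(** * Reciprocals and the case w = n/(n+1) *)

(** Geometric series of exponentials, that is Riemann sums for the integral of e^(-t(x+a)), converge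
    to the reciprocal. *)
Lemma dm_inv_shift (a : R) : 0 <= a -> diff_monotone (fun x => / (x + a)).
Proof.
  intros Ha.
  apply dm_lim with (fun N x => step N * / (1 - exp (- ((x + a) * step N)))).
  - intros y Hy. apply step_inv_exp_lim. lra.
  - intros N. pose proof (step_pos N) as P.
    apply dm_scal; [lra|].
    apply dm_series with (fun i x => exp (- (INR i * step N * a)) * exp (- (INR i * step N * x))).
    + intros i. apply dm_scal; [apply Rlt_le, exp_pos|]. apply dm_exp.
      apply Rmult_le_pos; [apply pos_INR|lra].
    + intros y Hy.
      apply is_series_ext with (fun i => exp (- ((y + a) * step N)) ^ i).
      * intros i. rewrite exp_pow_nat, <- exp_plus. f_equal. ring.
      * apply is_series_geom.
        pose proof (exp_opp_lt_1 ((y + a) * step N) ltac:(nra)).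
        rewrite Rabs_pos_eq; lra.
Qed.

Lemma dm_dzeta (m : nat) : (3 <= m)%nat -> diff_monotone (dzeta m).
Proof.
  intros Hm.
  apply dm_series with (fun k x => (1 + INR k) * (/ (x + INR k)) ^ m).
  - intros k. pose proof (pos_INR k). apply dm_scal; [lra|].
    apply dm_pow, dm_inv_shift; lra.
  - intros y Hy.
    apply is_series_ext with (fun k => (1 + INR k) / (y + INR k) ^ m).
    + intros k. now rewrite pow_inv.
    + apply Series_correct. now apply ex_series_dzeta.
Qed.

(* Symmetrising the double sum, (x+j)^-m (x+k)^-(m+2) becomes half of
   (j-k)^2 (x+j)^-(m+2) (x+k)^-(m+2) plus (x+j)^-(m+1) (x+k)^-(m+1). *)
Lemma dm_dzeta_cauchy_schwarz (m : nat) : (3 <= m)%nat ->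
  diff_monotone (fun x => dzeta m x * dzeta (m + 2) x - dzeta (m + 1) x ^ 2).
Proof.
  intros Hm.
  set (s := fun m N x => sum_f_R0 (fun k => (1 + INR k) / (x + INR k) ^ m) N).
  assert (L : forall m, (3 <= m)%nat -> forall y, 0 < y ->
    is_lim_seq (fun N => s m N y) (dzeta m y)).
  { intros m' Hm' y Hy. apply is_series_sum_f, Series_correct. now apply ex_series_dzeta. }
  apply dm_lim with (fun N x => s m N x * s (m + 2)%nat N x - s (m + 1)%nat N x ^ 2).
  { intros y Hy. apply is_lim_seq_minus'; [apply is_lim_seq_mult'|apply is_lim_seq_pow];
      apply L; lia || assumption. }
  set (e := fun j k x => (1 + INR j) * (1 + INR k) * (INR j - INR k) ^ 2 *
     ((/ (x + INR j)) ^ (m + 2) * (/ (x + INR k)) ^ (m + 2))).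
  assert (He : forall j k, diff_monotone (e j k)).
  { intros j k. pose proof (pos_INR j). pose proof (pos_INR k).
    apply dm_scal.
    - apply Rmult_le_pos; [apply Rmult_le_pos; lra|apply pow2_ge_0].
    - apply dm_mult; apply dm_pow, dm_inv_shift; assumption. }
  intros N. induction N as [|N IH].
  - apply dm_ext with (fun _ => 0); [|apply dm_const; lra].
    intros y Hy. unfold s. cbn [sum_f_R0]. simpl INR.
    rewrite !pow_add. field. split; [lra|apply pow_nonzero; lra].
  (* Passing from [N] to [S N] adds exactly the pairs (j, [S N]) with j <= N. *)
  - apply dm_ext with (fun x => (s m N x * s (m + 2)%nat N x - s (m + 1)%nat N x ^ 2) +
      sum_f_R0 (fun j => e j (S N) x) N).
    2: { apply dm_plus; [exact IH|]. apply (dm_sum (fun j => e j (S N))). intros; apply He. }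
    intros y Hy.
    set (V := / (y + INR (S N))). set (c := 1 + INR (S N)).
    assert (PV : y + INR (S N) <> 0) by (pose proof (pos_INR (S N)); lra).
    assert (E : sum_f_R0 (fun j => e j (S N) y) N =
      s m N y * (c * V ^ (m + 2)) + s (m + 2)%nat N y * (c * V ^ m)
      - 2 * c * V ^ (m + 1) * s (m + 1)%nat N y).
    { unfold s. rewrite (Rmult_comm (sum_f_R0 _ N)), (Rmult_comm (sum_f_R0 _ N) (c * V ^ m)).
      rewrite !scal_sum, <- sum_plus, <- minus_sum. apply sum_eq. intros j Hj.
      unfold e. fold V c. unfold Rdiv. rewrite <- !pow_inv.
      set (U := / (y + INR j)).
      assert (PU : y + INR j <> 0) by (pose proof (pos_INR j); lra).
      assert (EU : U * (y + INR j) = 1) by (unfold U; field; assumption).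
      assert (EV : V * (y + INR (S N)) = 1) by (unfold V; field; assumption).
      (* Its square replaces (j-k)^2 U^2 V^2 by (V-U)^2, whose expansion gives the three sums in
         [E]. *)
      assert (EUV : (INR j - INR (S N)) * (U * V) = V - U).
      { transitivity (V * (U * (y + INR j)) - U * (V * (y + INR (S N)))); [ring|].
        rewrite EU, EV. ring. }
      rewrite !pow_add.
      transitivity ((1 + INR j) * c * (U ^ m * V ^ m) *
        ((INR j - INR (S N)) * (U * V)) ^ 2); [ring|].
      rewrite EUV. ring. }
    rewrite E. unfold s. cbn [sum_f_R0]. unfold Rdiv. fold c.
    rewrite <- !(pow_inv (y + INR (S N))). fold V. rewrite !pow_add. ring.
Qed.

(** * Derivatives, asymptotics and the theorem *)

Lemma is_derive_quadratic (f : R -> R) (x l C r : R) : 0 < r -> 0 <= C ->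
  (forall h, Rabs h < r -> Rabs (f (x + h) - f x - h * l) <= C * h ^ 2) ->
  is_derive f x l.
Proof.
  intros Hr HC H. apply is_derive_Reals. intros eps He.
  assert (Hd : 0 < Rmin r (eps / (C + 1))).
  { apply Rmin_pos; [assumption|]. apply Rdiv_lt_0_compat; lra. }
  exists (mkposreal _ Hd). intros h Hh Hlt. simpl in Hlt.
  assert (H1 := Rlt_le_trans _ _ _ Hlt (Rmin_l _ _)).
  assert (H2 := Rlt_le_trans _ _ _ Hlt (Rmin_r _ _)).
  specialize (H h H1).
  pose proof (Rabs_pos_lt h Hh) as Ph.
  replace ((f (x + h) - f x) / h - l) with ((f (x + h) - f x - h * l) / h)
    by (field; assumption).
  rewrite Rabs_div by assumption.
  apply Rmult_lt_reg_r with (Rabs h); [assumption|].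
  unfold Rdiv. rewrite Rmult_assoc, Rinv_l, Rmult_1_r by lra.
  eapply Rle_lt_trans; [exact H|].
  rewrite <- (pow2_abs h).
  apply Rmult_lt_compat_r with (r := C + 1) in H2; [|lra].
  unfold Rdiv in H2. rewrite Rmult_assoc, Rinv_l, Rmult_1_r in H2 by lra.
  nra.
Qed.

(** For U = 1/y and V = 1/(y+h) this bounds the first-order Taylor remainder of y^(-m). The constant
    m^2 survives the induction because m^2 + m + 1 <= (m+1)^2. *)
Lemma inv_pow_taylor (U V E h : R) (m : nat) :
  0 <= U <= E -> 0 <= V <= E -> U - V = h * (U * V) ->
  Rabs (V ^ m - U ^ m + INR m * h * U ^ S m) <= INR m ^ 2 * h ^ 2 * E ^ (m + 2).
Proof.
  intros HU HV EUV. induction m as [|m IH].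
  - simpl. replace (1 - 1 + 0 * h * (U * 1)) with 0 by ring. rewrite Rabs_R0. lra.
  - replace (V ^ S m - U ^ S m + INR (S m) * h * U ^ S (S m)) with
      (V * (V ^ m - U ^ m + INR m * h * U ^ S m) +
       ((INR m + 1) * h * U ^ S m * (U - V) - U ^ m * (U - V - h * (U * V))))
      by (rewrite S_INR; simpl; ring).
    rewrite EUV.
    replace ((INR m + 1) * h * U ^ S m * (h * (U * V))
       - U ^ m * (h * (U * V) - h * (U * V)))
      with ((INR m + 1) * h ^ 2 * (U ^ (m + 2) * V))
      by (rewrite pow_add; simpl; ring).
    eapply Rle_trans; [apply Rabs_triang|].
    rewrite Rabs_mult, (Rabs_pos_eq V) by lra.
    pose proof (pos_INR m) as Hm. pose proof (pow2_ge_0 h) as Hh.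
    assert (PU : 0 <= U ^ (m + 2)) by (apply pow_le; lra).
    assert (K : U ^ (m + 2) <= E ^ (m + 2)) by (apply pow_incr; lra).
    rewrite (Rabs_pos_eq ((INR m + 1) * h ^ 2 * (U ^ (m + 2) * V)))
      by (apply Rmult_le_pos; apply Rmult_le_pos; lra).
    assert (K1 : V * Rabs (V ^ m - U ^ m + INR m * h * U ^ S m) <=
      E * (INR m ^ 2 * h ^ 2 * E ^ (m + 2)))
      by (apply Rmult_le_compat; try lra; apply Rabs_pos).
    assert (K2 : U ^ (m + 2) * V <= E ^ (m + 2) * E) by (apply Rmult_le_compat; lra).
    apply Rmult_le_compat_l with (r := (INR m + 1) * h ^ 2) in K2;
      [|apply Rmult_le_pos; lra].
    assert (0 <= INR m * (h ^ 2 * (E ^ (m + 2) * E))).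
    { apply Rmult_le_pos; [lra|]. apply Rmult_le_pos; [lra|].
      apply Rmult_le_pos; lra. }
    rewrite S_INR. replace (E ^ (S m + 2)) with (E ^ (m + 2) * E) by (simpl; ring).
    nra.
Qed.

Lemma is_derive_dzeta (m : nat) (x : R) : (3 <= m)%nat -> 0 < x ->
  is_derive (dzeta m) x (- INR m * dzeta (S m) x).
Proof.
  intros Hm Hx.
  assert (Pm := pos_INR m).
  pose proof (ex_series_dzeta (m + 2) (x / 2) ltac:(lia) ltac:(lra)) as EM.
  (* For |h| < x/2 both x + k and x + h + k exceed x/2 + k, so the Taylor bounds at all k sum to a
     multiple of [dzeta (m + 2) (x / 2)]. *)
  apply is_derive_quadratic with (INR m ^ 2 * dzeta (m + 2) (x / 2)) (x / 2); [lra| |].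
  { apply Rmult_le_pos; [apply pow2_ge_0|]. apply Series_nonneg; [|exact EM].
    intros k. pose proof (pos_INR k).
    apply Rlt_le, Rdiv_lt_0_compat; [lra|apply pow_lt; lra]. }
  intros h Hh. apply Rabs_def2 in Hh.
  pose proof (ex_series_dzeta m x Hm Hx) as E0.
  pose proof (ex_series_dzeta m (x + h) Hm ltac:(lra)) as E1.
  pose proof (ex_series_dzeta (S m) x ltac:(lia) Hx) as E2.
  set (a := fun k => (1 + INR k) / (x + h + INR k) ^ m - (1 + INR k) / (x + INR k) ^ m
     + INR m * h * ((1 + INR k) / (x + INR k) ^ S m)).
  set (b := fun k => INR m ^ 2 * h ^ 2 * ((1 + INR k) / (x / 2 + INR k) ^ (m + 2))).
  assert (Ea : dzeta m (x + h) - dzeta m x - h * (- INR m * dzeta (S m) x) = Series a).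
  { unfold a. rewrite Series_plus, Series_minus, Series_scal_l; try assumption.
    - unfold dzeta. ring.
    - now apply (ex_series_minus (fun k => (1 + INR k) / (x + h + INR k) ^ m)).
    - now apply (ex_series_scal_l (INR m * h) (fun k => (1 + INR k) / (x + INR k) ^ S m)). }
  assert (Eb : INR m ^ 2 * dzeta (m + 2) (x / 2) * h ^ 2 = Series b).
  { unfold b. rewrite Series_scal_l. unfold dzeta. ring. }
  assert (Exb : ex_series b).
  { now apply (ex_series_scal_l (INR m ^ 2 * h ^ 2)
      (fun k => (1 + INR k) / (x / 2 + INR k) ^ (m + 2))). }
  rewrite Ea, Eb.
  assert (Hab : forall k, Rabs (a k) <= b k).
  { intros k. pose proof (pos_INR k) as Pk. unfold a, b, Rdiv. rewrite <- !pow_inv.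
    pose proof (inv_pow_taylor (/ (x + INR k)) (/ (x + h + INR k)) (/ (x * / 2 + INR k)) h m)
      as T.
    replace ((1 + INR k) * (/ (x + h + INR k)) ^ m - (1 + INR k) * (/ (x + INR k)) ^ m +
      INR m * h * ((1 + INR k) * (/ (x + INR k)) ^ S m)) with
      ((1 + INR k) * ((/ (x + h + INR k)) ^ m - (/ (x + INR k)) ^ m +
      INR m * h * (/ (x + INR k)) ^ S m)) by ring.
    rewrite Rabs_mult, (Rabs_pos_eq (1 + INR k)) by lra.
    replace (INR m ^ 2 * h ^ 2 * ((1 + INR k) * (/ (x * / 2 + INR k)) ^ (m + 2))) with
      ((1 + INR k) * (INR m ^ 2 * h ^ 2 * (/ (x * / 2 + INR k)) ^ (m + 2))) by ring.
    apply Rmult_le_compat_l; [lra|]. apply T.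
    - split; [apply Rlt_le, Rinv_0_lt_compat; lra|apply Rinv_le_contravar; lra].
    - split; [apply Rlt_le, Rinv_0_lt_compat; lra|apply Rinv_le_contravar; lra].
    - field. lra. }
  assert (Exa : ex_series (fun k => Rabs (a k))).
  { apply ex_series_dom with b; [|assumption]. intros k. rewrite Rabs_Rabsolu. apply Hab. }
  eapply Rle_trans; [now apply Series_Rabs|].
  apply Series_le; [|assumption]. intros k. split; [apply Rabs_pos|apply Hab].
Qed.

(** The algebra generated by the series is closed under differentiation, so its members are smooth
    and no formula for higher derivatives has to be written. *)
Inductive dzeta_alg : (R -> R) -> Prop :=
| dzeta_alg_gen (m : nat) : (3 <= m)%nat -> dzeta_alg (dzeta m)
| dzeta_alg_const (c : R) : dzeta_alg (fun _ => c)
| dzeta_alg_plus (f g : R -> R) :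
    dzeta_alg f -> dzeta_alg g -> dzeta_alg (fun x => f x + g x)
| dzeta_alg_mult (f g : R -> R) :
    dzeta_alg f -> dzeta_alg g -> dzeta_alg (fun x => f x * g x).

Lemma dzeta_alg_derive (f : R -> R) : dzeta_alg f ->
  exists f', dzeta_alg f' /\ forall x, 0 < x -> is_derive f x (f' x).
Proof.
  induction 1 as [m Hm|c|f g Hf [f' [Af Df]] Hg [g' [Ag Dg]]
                 |f g Hf [f' [Af Df]] Hg [g' [Ag Dg]]].
  - exists (fun x => - INR m * dzeta (S m) x). split.
    + apply (dzeta_alg_mult (fun _ => - INR m)); [constructor|constructor; lia].
    + intros x Hx. now apply is_derive_dzeta.
  - exists (fun _ => 0). split; [constructor|]. intros x _. apply @is_derive_const.
  - exists (fun x => f' x + g' x). split; [now constructor|].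
    intros x Hx. apply @is_derive_plus; auto.
  - exists (fun x => f' x * g x + f x * g' x). split.
    + apply (dzeta_alg_plus (fun x => f' x * g x)); now constructor.
    + intros x Hx.
      apply (is_derive_mult f g x (f' x) (g' x)); auto. intros; apply Rmult_comm.
Qed.

Lemma locally_pos (x : R) (P : R -> Prop) :
  0 < x -> (forall y, 0 < y -> P y) -> locally x P.
Proof. intros Hx H. generalize (open_gt 0 x Hx). apply filter_imp. exact H. Qed.

Lemma dzeta_alg_smooth (f : R -> R) : dzeta_alg f ->
  forall k x, 0 < x -> ex_derive_n f k x.
Proof.
  intros Hf.
  assert (H : forall k, exists g, dzeta_alg g /\ forall x, 0 < x -> Derive_n f k x = g x).
  { induction k as [|k [g [Ag Eg]]]; [now exists f|].
    destruct (dzeta_alg_derive g Ag) as [g' [Ag' Dg]].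
    exists g'. split; [assumption|]. intros x Hx. simpl.
    rewrite (Derive_ext_loc _ g) by (now apply locally_pos).
    now apply is_derive_unique, Dg. }
  intros [|k] x Hx; [exact I|].
  destruct (H k) as [g [Ag Eg]]. destruct (dzeta_alg_derive g Ag) as [g' [_ Dg]].
  simpl. apply ex_derive_ext_loc with g.
  - apply locally_pos; [assumption|]. intros; symmetry; auto.
  - exists (g' x). now apply Dg.
Qed.

(** With n = m + 3 the signs cancel in both products, and n!^2 and (n-1)!(n+1)! share the factor
    (n-1)!^2 n, leaving n and n + 1. *)
Lemma F_omega_dzeta (m : nat) (w x : R) :
  F_omega (m + 3) w x = INR (Factorial.fact (m + 2)) ^ 2 * (INR m + 3) *
    ((INR m + 3) * dzeta (m + 4) x ^ 2 -
     w * (INR m + 4) * (dzeta (m + 3) x * dzeta (m + 5) x)).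
Proof.
  unfold F_omega, psi2.
  replace (m + 3 - 1)%nat with (m + 2)%nat by lia.
  replace (m + 3 + 1 + 1)%nat with (m + 5)%nat by lia.
  replace (m + 3 + 1)%nat with (S (m + 3)) by lia.
  replace (m + 2 + 1)%nat with (m + 3)%nat by lia.
  assert (F1 : INR (Factorial.fact (m + 3)) = (INR m + 3) * INR (Factorial.fact (m + 2))).
  { replace (m + 3)%nat with (S (m + 2)) by lia. rewrite fact_simpl, mult_INR.
    rewrite S_INR, plus_INR. simpl (INR 2). ring. }
  assert (F2 : INR (Factorial.fact (S (m + 3))) =
     (INR m + 4) * ((INR m + 3) * INR (Factorial.fact (m + 2)))).
  { rewrite <- F1, fact_simpl, mult_INR, S_INR, plus_INR. simpl (INR 3). ring. }
  rewrite F1, F2. replace (S (m + 3)) with (m + 4)%nat by lia.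
  fold (dzeta (m + 3) x) (dzeta (m + 4) x) (dzeta (m + 5) x).
  rewrite !pow_add.
  assert (Es : (-1) ^ m * (-1) ^ m = 1).
  { rewrite <- Rpow_mult_distr. replace (-1 * -1) with 1 by ring. apply pow1. }
  set (s := (-1) ^ m) in *. set (a := INR (Factorial.fact (m + 2))).
  simpl pow.
  transitivity ((s * s) * (a * a * (INR m + 3) * ((INR m + 3) * (dzeta (m + 4) x * dzeta (m + 4) x) -
     w * (INR m + 4) * (dzeta (m + 3) x * dzeta (m + 5) x)))); [ring|].
  rewrite Es. ring.
Qed.

Lemma F_omega_smooth (m : nat) (w c : R) (k : nat) (x : R) : 0 < x ->
  ex_derive_n (fun x => c * F_omega (m + 3) w x) k x.
Proof.
  intros Hx.
  apply ex_derive_n_ext with (fun x => (c * (INR (Factorial.fact (m + 2)) ^ 2 * (INR m + 3))) *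
    ((INR m + 3) * (dzeta (m + 4) x * dzeta (m + 4) x) +
     (- (w * (INR m + 4))) * (dzeta (m + 3) x * dzeta (m + 5) x))).
  { intros y. rewrite F_omega_dzeta. ring. }
  apply dzeta_alg_smooth; [|assumption].
  apply (dzeta_alg_mult (fun _ => _)); [constructor|].
  apply (dzeta_alg_plus (fun _ => _) (fun _ => _)); apply (dzeta_alg_mult (fun _ => _));
    try constructor; constructor; lia.
Qed.

(** * Asymptotics at 0 *)

(** The term k = 0 is exactly x^(-m), and the rest stays bounded as x tends to 0. *)
Lemma dzeta_lim_0 (m : nat) : (3 <= m)%nat ->
  is_lim_seq (fun N => step N ^ m * dzeta m (step N)) 1.
Proof.
  intros Hm.
  set (t := fun k => (1 + INR k) / (1 + INR k) ^ m).
  assert (Et : ex_series t) by (apply ex_series_dzeta; lra || assumption).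
  apply is_lim_seq_le_le with (fun _ => 1) (fun N => 1 + step N ^ m * (2 * Series t)).
  - intros N. pose proof (step_pos N) as P.
    pose proof (pow_lt _ m P) as Pm.
    pose proof (ex_series_dzeta m (step N) Hm P) as E.
    unfold dzeta. rewrite Series_incr_1 by assumption.
    set (T := Series (fun k => (1 + INR (S k)) / (step N + INR (S k)) ^ m)).
    assert (B : forall k, 0 <= (1 + INR (S k)) / (step N + INR (S k)) ^ m <= 2 * t k).
    { intros k. pose proof (pos_INR k). rewrite S_INR.
      assert (0 < (1 + INR k) ^ m) by (apply pow_lt; lra).
      assert ((1 + INR k) ^ m <= (step N + (INR k + 1)) ^ m) by (apply pow_incr; lra).
      split; [apply Rlt_le, Rdiv_lt_0_compat; lra|].
      unfold t, Rdiv. rewrite <- Rmult_assoc.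
      apply Rmult_le_compat; try lra.
      - apply Rlt_le, Rinv_0_lt_compat; lra.
      - apply Rinv_le_contravar; lra. }
    assert (BT : 0 <= T <= 2 * Series t).
    { split.
      - apply Series_nonneg; [intros k; apply B|].
        now apply (ex_series_incr_1 (fun k => (1 + INR k) / (step N + INR k) ^ m)).
      - rewrite <- Series_scal_l. apply Series_le; [apply B|].
        now apply (ex_series_scal_l 2 t). }
    simpl (INR 0). rewrite !Rplus_0_r.
    replace (step N ^ m * (1 / step N ^ m + T)) with (1 + step N ^ m * T) by (field; lra).
    split.
    + assert (0 <= step N ^ m * T) by (apply Rmult_le_pos; lra). lra.
    + apply Rplus_le_compat_l, Rmult_le_compat_l; lra.
  - apply is_lim_seq_const.
  - replace (Finite 1) with (Finite (1 + 0 ^ m * (2 * Series t)))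
      by (f_equal; rewrite pow_i by lia; ring).
    apply is_lim_seq_plus'; [apply is_lim_seq_const|].
    apply is_lim_seq_mult'; [apply is_lim_seq_pow, step_lim|apply is_lim_seq_const].
Qed.

(** * Asymptotics at infinity *)

(** Bounds the decrement of c^(-r) by its slope at the two end points; summed, this replaces an
    integral comparison by a telescoping series. *)
Lemma inv_pow_telescope (c : R) (r : nat) : 0 < c ->
  INR r * (/ (c + 1)) ^ S r <= (/ c) ^ r - (/ (c + 1)) ^ r <= INR r * (/ c) ^ S r.
Proof.
  intros Hc.
  set (u := / c). set (v := / (c + 1)).
  assert (Pv : 0 < v) by (apply Rinv_0_lt_compat; lra).
  assert (Huv : v <= u) by (apply Rinv_le_contravar; lra).
  assert (E : u - v = u * v) by (unfold u, v; field; lra).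
  induction r as [|r [IH1 IH2]]; [simpl; lra|].
  assert (Pvr : 0 < v ^ r) by (apply pow_lt; lra).
  assert (Pur : v ^ r <= u ^ r) by (apply pow_incr; lra).
  pose proof (pos_INR r) as Hr.
  assert (ES : u ^ S r - v ^ S r = u * (u ^ r - v ^ r) + u * v * v ^ r).
  { rewrite <- E. simpl. ring. }
  rewrite ES, S_INR. cbn [pow] in *.
  split.
  - apply Rmult_le_compat_l with (r := u) in IH1; [|lra].
    assert (K : 0 <= (u - v) * (v * v ^ r)) by (apply Rmult_le_pos; nra).
    assert (0 <= INR r * ((u - v) * (v * v ^ r))) by (apply Rmult_le_pos; lra).
    nra.
  - apply Rmult_le_compat_l with (r := u) in IH2; [|lra].
    assert (K : u * v * v ^ r <= u * u * u ^ r) by (apply Rmult_le_compat; nra).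
    nra.
Qed.

Lemma is_series_telescope (u : nat -> R) :
  is_lim_seq u 0 -> is_series (fun k => u k - u (S k)) (u O).
Proof.
  intros H. apply is_series_sum_f.
  apply is_lim_seq_ext with (fun N => u O - u (S N)).
  - intros N. induction N as [|N IH]; simpl; [ring|]. simpl in IH. rewrite <- IH. ring.
  - replace (u O) with (u O - 0) at 1 by ring.
    apply is_lim_seq_minus'; [apply is_lim_seq_const|].
    now apply (is_lim_seq_incr_1 u).
Qed.

Lemma is_series_inv_pow_telescope (c : R) (r : nat) : 0 < c -> (1 <= r)%nat ->
  is_series (fun k => (/ (c + INR k)) ^ r - (/ (c + INR k + 1)) ^ r) ((/ c) ^ r).
Proof.
  intros Hc Hr.
  pose proof (is_series_telescope (fun k => (/ (c + INR k)) ^ r)) as H.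
  cbv beta in H. simpl (INR 0) in H. rewrite Rplus_0_r in H.
  eapply is_series_ext; [|apply H].
  - intros k. cbv beta. rewrite S_INR, <- Rplus_assoc. reflexivity.
  - replace (Finite 0) with (Finite (0 ^ r)) by (f_equal; apply pow_i; lia).
    apply is_lim_seq_pow.
    apply (is_lim_seq_inv (fun k => c + INR k) p_infty); [|discriminate].
    eapply is_lim_seq_plus; [apply is_lim_seq_const|apply is_lim_seq_INR|reflexivity].
Qed.

(** The Hurwitz zeta function. *)
Definition hzeta (p : nat) (x : R) : R := Series (fun k => (/ (x + INR k)) ^ p).

Lemma ex_series_hzeta (p : nat) (x : R) : 1 < x -> (2 <= p)%nat ->
  ex_series (fun k => (/ (x + INR k)) ^ p).
Proof.
  intros Hx Hp.
  apply ex_series_dom with (fun k => x * ((1 + INR k) / (x + INR k) ^ S p)).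
  - intros k. pose proof (pos_INR k).
    assert (P : 0 < (x + INR k) ^ p) by (apply pow_lt; lra).
    rewrite pow_inv, Rabs_pos_eq by (apply Rlt_le, Rinv_0_lt_compat; lra).
    apply Rmult_le_reg_r with ((x + INR k) ^ S p); [apply pow_lt; lra|].
    replace (x * ((1 + INR k) / (x + INR k) ^ S p) * (x + INR k) ^ S p) with
      (x * (1 + INR k)) by (simpl; field; split; lra).
    replace (/ (x + INR k) ^ p * (x + INR k) ^ S p) with (x + INR k)
      by (simpl; field; lra).
    nra.
  - apply (ex_series_scal_l x (fun k => (1 + INR k) / (x + INR k) ^ S p)).
    apply ex_series_dzeta; [lia|lra].
Qed.

Lemma hzeta_bounds (r : nat) (x : R) : 1 < x -> (1 <= r)%nat ->
  (/ x) ^ r <= INR r * hzeta (S r) x <= (/ (x - 1)) ^ r.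
Proof.
  intros Hx Hr.
  pose proof (Series_correct _ (ex_series_hzeta (S r) x Hx ltac:(lia))) as H.
  apply (is_series_scal_l (INR r)) in H.
  split.
  - refine (is_series_le _ _ _ _ _ (is_series_inv_pow_telescope x r ltac:(lra) Hr) H).
    intros k. pose proof (pos_INR k). apply inv_pow_telescope. lra.
  - refine (is_series_le _ _ _ _ _ H
      (is_series_inv_pow_telescope (x - 1) r ltac:(lra) Hr)).
    intros k. pose proof (pos_INR k).
    pose proof (inv_pow_telescope (x - 1 + INR k) r ltac:(lra)) as [T _].
    replace (x - 1 + INR k + 1) with (x + INR k) in * by ring. exact T.
Qed.

Lemma hzeta_lim (r : nat) : (1 <= r)%nat ->
  is_lim_seq (fun N => (INR N + 2) ^ r * hzeta (S r) (INR N + 2)) (/ INR r).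
Proof.
  intros Hr. assert (Pr : 0 < INR r) by (apply lt_0_INR; lia).
  apply is_lim_seq_le_le with (fun _ => / INR r) (fun N => (1 + step N) ^ r * / INR r).
  - intros N. pose proof (pos_INR N).
    pose proof (hzeta_bounds r (INR N + 2) ltac:(lra) Hr) as [B1 B2].
    assert (P : 0 < (INR N + 2) ^ r) by (apply pow_lt; lra).
    apply Rmult_le_compat_l with (r := (INR N + 2) ^ r) in B1, B2; [|lra|lra].
    rewrite <- Rpow_mult_distr, Rinv_r, pow1 in B1 by lra.
    rewrite <- Rpow_mult_distr in B2.
    replace ((INR N + 2) * / (INR N + 2 - 1)) with (1 + step N) in B2
      by (unfold step; field; lra).
    split; apply Rmult_le_reg_r with (INR r); try lra.
    + rewrite Rinv_l by lra. lra.
    + rewrite (Rmult_assoc _ (/ INR r)), Rinv_l by lra. lra.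
  - apply is_lim_seq_const.
  - replace (/ INR r) with ((1 + 0) ^ r * / INR r) at 1
      by (rewrite Rplus_0_r, pow1; ring).
    apply is_lim_seq_mult'; [|apply is_lim_seq_const].
    apply is_lim_seq_pow, is_lim_seq_plus'; [apply is_lim_seq_const|apply step_lim].
Qed.

(** Write the numerator as 1 + k = (x + k) - (x - 1). *)
Lemma dzeta_hzeta (p : nat) (x : R) : 1 < x -> (2 <= p)%nat ->
  dzeta (S p) x = hzeta p x - (x - 1) * hzeta (S p) x.
Proof.
  intros Hx Hp. unfold dzeta, hzeta.
  rewrite <- Series_scal_l, <- Series_minus.
  - apply Series_ext. intros k. pose proof (pos_INR k).
    unfold Rdiv. rewrite <- pow_inv. simpl. field. lra.
  - now apply ex_series_hzeta.
  - apply (ex_series_scal_l (x - 1) (fun k => (/ (x + INR k)) ^ S p)).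
    apply ex_series_hzeta; [assumption|lia].
Qed.

Lemma dzeta_lim_infty (m : nat) :
  is_lim_seq (fun N => (INR N + 2) ^ (m + 1) * dzeta (m + 3) (INR N + 2))
    (/ ((INR m + 1) * (INR m + 2))).
Proof.
  pose proof (pos_INR m) as Hm.
  (* At x = N + 2 the factor (x-1)/x is 1 - [step (S N)]. The limit is then 1/(m+1) - 1/(m+2). *)
  apply is_lim_seq_ext with (fun N => (INR N + 2) ^ (m + 1) * hzeta (S (m + 1)) (INR N + 2) -
    (1 - step (S N)) * ((INR N + 2) ^ (m + 2) * hzeta (S (m + 2)) (INR N + 2))).
  - intros N. pose proof (pos_INR N).
    replace (m + 3)%nat with (S (m + 2)) by lia.
    rewrite dzeta_hzeta by (lra || lia).
    replace (S (m + 1)) with (m + 2)%nat by lia.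
    replace ((INR N + 2) ^ (m + 2)) with ((INR N + 2) ^ (m + 1) * (INR N + 2))
      by (rewrite !pow_add; ring).
    unfold step. rewrite S_INR. field. lra.
  - replace (/ ((INR m + 1) * (INR m + 2))) with
      (/ INR (m + 1) - (1 - 0) * / INR (m + 2)).
    + apply is_lim_seq_minus'; [apply hzeta_lim; lia|].
      apply is_lim_seq_mult'; [|apply hzeta_lim; lia].
      apply is_lim_seq_minus'; [apply is_lim_seq_const|].
      apply (is_lim_seq_incr_1 step), step_lim.
    + rewrite !plus_INR. simpl. field. lra.
Qed.

Theorem theorem3p2 (n : nat) (w : R) (Hn : (3 <= n)%nat) :
  (completely_monotonic (F_omega n w) <-> w <= (INR n - 2) / (INR n - 1)) /\
  (completely_monotonic (fun x => - F_omega n w x) <-> w >= INR n / (INR n + 1)).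
Proof.
  destruct (Nat.le_exists_sub 3 n Hn) as [m [-> _]]. clear Hn.
  pose proof (pos_INR m) as Hm.
  replace (INR (m + 3)) with (INR m + 3) by (rewrite plus_INR; simpl; ring).
  replace (INR m + 3 - 2) with (INR m + 1) by ring.
  replace (INR m + 3 - 1) with (INR m + 2) by ring.
  replace (INR m + 3 + 1) with (INR m + 4) by ring.
  set (a := INR (Factorial.fact (m + 2)) ^ 2 * (INR m + 3)).
  assert (Pa : 0 < a).
  { apply Rmult_lt_0_compat; [apply pow_lt, INR_fact_lt_0|lra]. }
  assert (EF : forall x, F_omega (m + 3) w x = a * ((INR m + 3) * dzeta (m + 4) x ^ 2 -
     w * (INR m + 4) * (dzeta (m + 3) x * dzeta (m + 5) x)))
    by (intros; apply F_omega_dzeta).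
  assert (DD : diff_monotone (fun x => dzeta (m + 3) x * dzeta (m + 5) x))
    by (apply dm_mult; apply dm_dzeta; lia).
  split; split.
  - intros CM.
    (* Nonnegativity of F_n at x = N + 2, multiplied by x^(2m+4) so that every factor converges at
       infinity. *)
    assert (Pos : forall N, w * (INR m + 4) * (((INR N + 2) ^ (m + 1) * dzeta (m + 3) (INR N + 2)) *
       ((INR N + 2) ^ (S (S m) + 1) * dzeta (S (S m) + 3) (INR N + 2))) <=
       (INR m + 3) * ((INR N + 2) ^ (S m + 1) * dzeta (S m + 3) (INR N + 2)) ^ 2).
    { intros N. pose proof (pos_INR N).
      destruct (CM O (INR N + 2) ltac:(lra)) as [_ P]. simpl in P.
      rewrite Rmult_1_l, EF in P.
      replace (S m + 3)%nat with (m + 4)%nat by lia.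
      replace (S (S m) + 3)%nat with (m + 5)%nat by lia.
      set (X := INR N + 2) in *.
      set (B := (INR m + 3) * dzeta (m + 4) X ^ 2 -
        w * (INR m + 4) * (dzeta (m + 3) X * dzeta (m + 5) X)) in *.
      assert (PB : 0 <= B) by (apply Rmult_le_reg_l with a; lra).
      assert (PX : 0 <= (X ^ (S m + 1)) ^ 2 * B)
        by (apply Rmult_le_pos; [apply pow2_ge_0|assumption]).
      replace (X ^ (S (S m) + 1)) with (X ^ (S m + 1) * X) by (rewrite !pow_add; simpl; ring).
      replace (X ^ (S m + 1)) with (X ^ (m + 1) * X) in * by (rewrite !pow_add; simpl; ring).
      unfold B in PX. nra. }
    pose proof (dzeta_lim_infty m) as L0.
    pose proof (dzeta_lim_infty (S m)) as L1.
    pose proof (dzeta_lim_infty (S (S m))) as L2.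
    pose proof (is_lim_seq_le _ _ _ _ Pos
      (is_lim_seq_mult' _ _ _ _ (is_lim_seq_const (w * (INR m + 4)))
         (is_lim_seq_mult' _ _ _ _ L0 L2))
      (is_lim_seq_mult' _ _ _ _ (is_lim_seq_const (INR m + 3))
         (is_lim_seq_pow _ _ 2 L1))) as Lim.
    cbn [Rbar_le] in Lim. rewrite !S_INR in Lim.
    apply Rmult_le_compat_r with
      (r := (INR m + 1) * (INR m + 2) * (INR m + 3)) in Lim;
      [|repeat apply Rmult_le_pos; lra].
    replace (w * (INR m + 4) * (/ ((INR m + 1) * (INR m + 2)) *
      / ((INR m + 1 + 1 + 1) * (INR m + 1 + 1 + 2))) *
      ((INR m + 1) * (INR m + 2) * (INR m + 3))) with w in Lim by (field; lra).
    eapply Rle_trans; [exact Lim|]. right. field. lra.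
  - intros Hw.
    apply dm_completely_monotonic.
    + intros k x Hx. apply ex_derive_n_ext with (fun x => 1 * F_omega (m + 3) w x).
      * intros; ring.
      * now apply F_omega_smooth.
    (* The extremal case w = (n-2)/(n-1) plus a nonnegative multiple of f_(n-1) f_(n+1). *)
    + apply dm_ext with (fun x => a * (/ (INR m + 2) * ((INR m + 2) * (INR m + 3) * dzeta (m + 4) x ^ 2 -
        (INR m + 1) * (INR m + 4) * dzeta (m + 3) x * dzeta (m + 5) x) +
        (INR m + 4) * ((INR m + 1) / (INR m + 2) - w) * (dzeta (m + 3) x * dzeta (m + 5) x))).
      { intros y _. rewrite EF. field. lra. }
      apply dm_scal; [lra|]. apply dm_plus; apply dm_scal.
      * apply Rlt_le, Rinv_0_lt_compat; lra.
      * apply dm_dzeta_turan.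
      * apply Rmult_le_pos; lra.
      * exact DD.
  - intros CM.
    (* Here F_n <= 0 is used along x = [step N], multiplied by x^(2m+8); all scaled series tend to
       1, which leaves n <= w(n+1). *)
    assert (Pos : forall N, (INR m + 3) * (step N ^ (m + 4) * dzeta (m + 4) (step N)) ^ 2 <=
       w * (INR m + 4) * ((step N ^ (m + 3) * dzeta (m + 3) (step N)) *
       (step N ^ (m + 5) * dzeta (m + 5) (step N)))).
    { intros N. pose proof (step_pos N) as PS.
      destruct (CM O (step N) PS) as [_ P]. simpl in P.
      rewrite Rmult_1_l, EF in P.
      set (X := step N) in *.
      set (B := (INR m + 3) * dzeta (m + 4) X ^ 2 -
        w * (INR m + 4) * (dzeta (m + 3) X * dzeta (m + 5) X)) in *.
      assert (PB : 0 <= - B) by (apply Rmult_le_reg_l with a; lra).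
      assert (PX : 0 <= (X ^ (m + 4)) ^ 2 * - B)
        by (apply Rmult_le_pos; [apply pow2_ge_0|assumption]).
      replace (X ^ (m + 5)) with (X ^ (m + 3) * X * X) by (rewrite !pow_add; simpl; ring).
      replace (X ^ (m + 4)) with (X ^ (m + 3) * X) in * by (rewrite !pow_add; simpl; ring).
      unfold B in PX. nra. }
    pose proof (dzeta_lim_0 (m + 3) ltac:(lia)) as L0.
    pose proof (dzeta_lim_0 (m + 4) ltac:(lia)) as L1.
    pose proof (dzeta_lim_0 (m + 5) ltac:(lia)) as L2.
    pose proof (is_lim_seq_le _ _ _ _ Pos
      (is_lim_seq_mult' _ _ _ _ (is_lim_seq_const (INR m + 3))
         (is_lim_seq_pow _ _ 2 L1))
      (is_lim_seq_mult' _ _ _ _ (is_lim_seq_const (w * (INR m + 4)))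
         (is_lim_seq_mult' _ _ _ _ L0 L2))) as Lim.
    cbn [Rbar_le] in Lim. apply Rle_ge.
    apply Rmult_le_reg_r with (INR m + 4); [lra|].
    replace ((INR m + 3) / (INR m + 4) * (INR m + 4)) with (INR m + 3) by (field; lra).
    lra.
  - intros Hw. apply Rge_le in Hw.
    apply dm_completely_monotonic.
    + intros k x Hx. apply ex_derive_n_ext with (fun x => -1 * F_omega (m + 3) w x).
      * intros; ring.
      * now apply F_omega_smooth.
    + pose proof (dm_dzeta_cauchy_schwarz (m + 3) ltac:(lia)) as CS.
      replace (m + 3 + 2)%nat with (m + 5)%nat in CS by lia.
      replace (m + 3 + 1)%nat with (m + 4)%nat in CS by lia.
      (* The extremal case w = n/(n+1), again plus a nonnegative multiple of the product. *)
      apply dm_ext with (fun x => a * ((INR m + 3) *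
        (dzeta (m + 3) x * dzeta (m + 5) x - dzeta (m + 4) x ^ 2) +
        (INR m + 4) * (w - (INR m + 3) / (INR m + 4)) * (dzeta (m + 3) x * dzeta (m + 5) x))).
      { intros y _. rewrite EF. field. lra. }
      apply dm_scal; [lra|]. apply dm_plus; apply dm_scal.
      * lra.
      * exact CS.
      * apply Rmult_le_pos; lra.
      * exact DD.
Qed.
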